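(* There exist a stable 2-coloring of pairs $f:[\omega]^2\to 2$ and a family $Y$ of infinite subsets of $\omega$ such that (i) for every $P\in Y$, no $(f\oplus P)$-computable set is homogeneous for $f$; and (ii) every stable 2-coloring of pairs $f':[\omega]^2\to 2$ with $f'\le_T f$ either has an $(f\oplus P)$-computable p-homogeneous set for some $P\in Y$, or else has some p-homogeneous set which computes no set homogeneous for $f$.
   Context: A 2-coloring of pairs is $f:[\omega]^2\to 2$, with $f(x,y)$ meaning $f(\{x,y\})$ for $x<y$; it is stable if $\lim_u f(x,u)$ exists for all $x$. $A\oplus B=\{2x:x\in A\}\cup\{2y+1:y\in B\}$. An infinite set $H$ is homogeneous for $f$ if $f$ is constant on $[H]^2$. A set $H=H_L\oplus H_R$ with $H_L,H_R$ infinite is p-homogeneous for a coloring $g$ if $g(\{x,y\})$ is constant over $x\in H_L$, $y\in H_R$, $x\neq y$. *)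

(* Defs.v *)
From Stdlib Require Import Arith List Cantor.
Import ListNotations.

Definition set_nat := nat -> bool.

Definition infinite (A : set_nat) : Prop :=
  forall n, exists m, n <= m /\ A m = true.

(* A 2-coloring of pairs f : [omega]^2 -> 2 is given by f x y for x < y;
   values with x >= y are irrelevant. *)
Definition coloring := nat -> nat -> bool.

Definition colsym (f : coloring) (x y : nat) : bool :=
  if x <? y then f x y else f y x.

Definition stable (f : coloring) : Prop :=
  forall x, exists c N, forall u, N <= u -> x < u -> f x u = c.

Definition homogeneous (f : coloring) (H : set_nat) : Prop :=
  infinite H /\
  exists c, forall x y, H x = true -> H y = true -> x < y -> f x y = c.

Definition join (A B : set_nat) : set_nat :=
  fun n => if Nat.odd n then B (Nat.div2 n) else A (Nat.div2 n).

Definition p_homogeneous_pair (g : coloring) (HL HR : set_nat) : Prop :=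
  infinite HL /\ infinite HR /\
  exists c, forall x y, HL x = true -> HR y = true -> x <> y -> colsym g x y = c.

Definition p_homogeneous (g : coloring) (H : set_nat) : Prop :=
  exists HL HR, p_homogeneous_pair g HL HR /\ forall n, H n = join HL HR n.

Definition oracle := nat -> nat.

Definition set_oracle (A : set_nat) : oracle := fun n => if A n then 1 else 0.

Definition col_oracle (f : coloring) : oracle :=
  fun n => let (x, y) := Cantor.of_nat n in
           if x <? y then (if f x y then 1 else 0) else 0.

Definition ojoin (o1 o2 : oracle) : oracle :=
  fun n => if Nat.odd n then o2 (Nat.div2 n) else o1 (Nat.div2 n).

Inductive code : Type :=
| CZero : code
| CSucc : code
| CProj : nat -> code
| COracle : code
| CComp : code -> list code -> code
| CPrim : code -> code -> code
| CMu : code -> code.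

Inductive eval (o : oracle) : code -> list nat -> nat -> Prop :=
| ev_zero args : eval o CZero args 0
| ev_succ args : eval o CSucc args (S (hd 0 args))
| ev_proj i args : eval o (CProj i) args (nth i args 0)
| ev_oracle args : eval o COracle args (o (hd 0 args))
| ev_comp f gs args vs v :
    evals o gs args vs -> eval o f vs v -> eval o (CComp f gs) args v
| ev_prim0 f g rest v :
    eval o f rest v -> eval o (CPrim f g) (0 :: rest) v
| ev_primS f g n rest r v :
    eval o (CPrim f g) (n :: rest) r ->
    eval o g (n :: r :: rest) v ->
    eval o (CPrim f g) (S n :: rest) v
| ev_mu f args n :
    eval o f (n :: args) 0 ->
    (forall m, m < n -> exists v, v <> 0 /\ eval o f (m :: args) v) ->
    eval o (CMu f) args n
with evals (o : oracle) : list code -> list nat -> list nat -> Prop :=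
| evs_nil args : evals o [] args []
| evs_cons g gs args v vs :
    eval o g args v -> evals o gs args vs -> evals o (g :: gs) args (v :: vs).

Definition Tred (g o : oracle) : Prop :=
  exists e, forall n, eval o e [n] (g n).

Definition computable_in (X : set_nat) (o : oracle) : Prop :=
  Tred (set_oracle X) o.

(* Main.v *)
Require Import Defs.
From Stdlib Require Import Arith List Cantor Lia Bool Classical ClassicalEpsilon.
Import ListNotations.

(** The coloring [f] is generic for finite colorings in which some points carry a promise (a lock)
    for their limit.  Alongside [f], and for every functional [e] giving a stable [f'], the
    forcing builds Mathias conditions: stems for two p-homogeneous sets of [f'], one of each
    color, and a common infinite reservoir.  If some reservoir [P] has all its limits of one color,
    [P] is put into [Y]: lock-genericity relative to [P] gives (i), and [f] and [P] compute a
    p-homogeneous set greedily.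

    Otherwise, given a functional for each of the two sets, suppose that no extension makes
    either output fail to be homogeneous for [f].  Then a point that must be output is always
    locked by the time the stem is settled, and playing the two colors against each other shows
    that (after thinning) settling a reservoir element [z] to a color amounts to locking one
    particular output [x_z] to a corresponding limit.  Among three successive outputs, two come from
    elements in the same half of the p-homogeneous set, where [f'] imposes no condition on the pair;
    locking [x_z] the wrong way while choosing the second element, and then reversing the lock,
    produces two outputs on which [f] has the wrong color. *)

(** * Oracle computations *)

Section EvalInduction.
Variables (o : oracle) (P : code -> list nat -> nat -> Prop)
  (Q : list code -> list nat -> list nat -> Prop).
Hypotheses
  (Hzero : forall a, P CZero a 0)
  (Hsucc : forall a, P CSucc a (S (hd 0 a)))
  (Hproj : forall i a, P (CProj i) a (nth i a 0))
  (Horac : forall a, P COracle a (o (hd 0 a)))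
  (Hcomp : forall f gs a vs v, Q gs a vs -> P f vs v -> P (CComp f gs) a v)
  (Hprim0 : forall f g rest v, P f rest v -> P (CPrim f g) (0 :: rest) v)
  (HprimS : forall f g n rest r v, P (CPrim f g) (n :: rest) r ->
     P g (n :: r :: rest) v -> P (CPrim f g) (S n :: rest) v)
  (Hmu : forall f a n, P f (n :: a) 0 ->
     (forall m, m < n -> exists v, v <> 0 /\ P f (m :: a) v) -> P (CMu f) a n)
  (Hnil : forall a, Q [] a [])
  (Hcons : forall g gs a v vs, P g a v -> Q gs a vs -> Q (g :: gs) a (v :: vs)).

(* The generated scheme has no induction hypothesis under the existential of [ev_mu]. *)
Fixpoint eval_strong_ind e a v (H : eval o e a v) {struct H} : P e a v
with evals_strong_ind gs a vs (H : evals o gs a vs) {struct H} : Q gs a vs.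
Proof.
- destruct H.
  + apply Hzero.
  + apply Hsucc.
  + apply Hproj.
  + apply Horac.
  + eapply Hcomp; [apply evals_strong_ind | apply eval_strong_ind]; eassumption.
  + apply Hprim0, eval_strong_ind; assumption.
  + eapply HprimS; apply eval_strong_ind; eassumption.
  + apply Hmu; [apply eval_strong_ind; assumption|].
    intros m Hm. destruct (H0 m Hm) as [v [Hv He]].
    exists v. split; [exact Hv | apply eval_strong_ind; exact He].
- destruct H.
  + apply Hnil.
  + apply Hcons; [apply eval_strong_ind | apply evals_strong_ind]; assumption.
Defined.
End EvalInduction.

(** Use principle: a convergent computation consults only finitely many oracle values. For [CMu] the
    bound also covers the finitely many tests below the result. *)
Lemma eval_use o e a v : eval o e a v ->
  exists N, forall o', (forall i, i < N -> o' i = o i) -> eval o' e a v.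
Proof.
apply (eval_strong_ind o
  (fun e a v => exists N, forall o', (forall i, i < N -> o' i = o i) -> eval o' e a v)
  (fun gs a vs => exists N, forall o', (forall i, i < N -> o' i = o i) -> evals o' gs a vs)).
- exists 0. constructor.
- exists 0. constructor.
- exists 0. constructor.
- intros b. exists (S (hd 0 b)). intros o' H. rewrite <- H by lia. constructor.
- intros f gs b vs w [N1 H1] [N2 H2]. exists (max N1 N2). intros o' H.
  apply ev_comp with vs; [apply H1 | apply H2]; intros; apply H; lia.
- intros f g rest w [N H]. exists N. intros. constructor. auto.
- intros f g n rest r w [N1 H1] [N2 H2]. exists (max N1 N2). intros o' H.
  apply ev_primS with r; [apply H1 | apply H2]; intros; apply H; lia.
- intros f b n [N H] Hm.
  assert (HM : exists M, forall o', (forall i, i < M -> o' i = o i) ->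
     forall m, m < n -> exists v0, v0 <> 0 /\ eval o' f (m :: b) v0).
  { clear H. induction n as [|n IH].
    - exists 0. intros. lia.
    - destruct IH as [M HM]; [intros; apply Hm; lia|].
      destruct (Hm n) as [w [Hw [N' HN']]]; [lia|].
      exists (max M N'). intros o' Ho m Hlt.
      destruct (Nat.eq_dec m n) as [->|Hne].
      + exists w. split; [exact Hw|]. apply HN'. intros; apply Ho; lia.
      + apply HM; [intros; apply Ho; lia | lia]. }
  destruct HM as [M HM]. exists (max N M). intros o' Ho. constructor.
  + apply H. intros; apply Ho; lia.
  + apply HM. intros; apply Ho; lia.
- exists 0. constructor.
- intros g gs b w ws [N1 H1] [N2 H2]. exists (max N1 N2). intros o' H.
  constructor; [apply H1 | apply H2]; intros; apply H; lia.
Qed.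

Lemma eval_det o e a v v' : eval o e a v -> eval o e a v' -> v = v'.
Proof.
intros H. revert v'. revert e a v H.
apply (eval_strong_ind o (fun e a v => forall v', eval o e a v' -> v = v')
  (fun gs a vs => forall vs', evals o gs a vs' -> vs = vs')).
- intros a v' H. inversion H. reflexivity.
- intros a v' H. inversion H. reflexivity.
- intros i a v' H. inversion H. reflexivity.
- intros a v' H. inversion H. reflexivity.
- intros f gs a vs v IHgs IHf v' H. inversion H; subst.
  apply IHf. erewrite IHgs by eassumption. assumption.
- intros f g rest v IH v' H. inversion H; subst. auto.
- intros f g n rest r v IHr IHv v' H. inversion H; subst.
  apply IHv. erewrite IHr by eassumption. assumption.
- intros f a n IH Hm v' H. inversion H as [| | | | | | |f' a' n' H1 H2]; subst.
  destruct (Nat.lt_trichotomy n v') as [Hlt|[Heq|Hlt]]; [|exact Heq|].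
  + destruct (H2 n Hlt) as [w [Hw He]]. apply IH in He. congruence.
  + destruct (Hm v' Hlt) as [w [Hw He]]. apply He in H1. congruence.
- intros a vs' H. inversion H. reflexivity.
- intros g gs a v vs IHg IHgs vs' H. inversion H; subst.
  f_equal; auto.
Qed.

(** Composition of reductions: each oracle query becomes a run of [c], which computes the first
    oracle from the second. *)
Fixpoint subst_oracle (c : code) (e : code) {struct e} : code :=
  match e with
  | COracle => c
  | CComp f gs => CComp (subst_oracle c f) (map (subst_oracle c) gs)
  | CPrim f g => CPrim (subst_oracle c f) (subst_oracle c g)
  | CMu f => CMu (subst_oracle c f)
  | e' => e'
  end.

Lemma eval_subst_oracle o1 o2 c :
  (forall a, eval o2 c a (o1 (hd 0 a))) ->
  forall e a v, eval o1 e a v -> eval o2 (subst_oracle c e) a v.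
Proof.
intros Hc.
apply (eval_strong_ind o1 (fun e a v => eval o2 (subst_oracle c e) a v)
  (fun gs a vs => evals o2 (map (subst_oracle c) gs) a vs)); simpl; intros;
  try (econstructor; eassumption).
- apply Hc.
Qed.

(** * Closure properties of functions computable from an oracle *)

Definition comp (o : oracle) (F : list nat -> nat) : Prop :=
  exists e, forall a, eval o e a (F a).

Section ComputableFunctions.
Variable o : oracle.

Lemma comp_ext F G : (forall a, F a = G a) -> comp o F -> comp o G.
Proof. intros H [e He]. exists e. intros a. rewrite <- H. apply He. Qed.

Lemma comp_proj i : comp o (fun a => nth i a 0).
Proof. exists (CProj i). constructor. Qed.

Lemma comp_app1 F G : comp o F -> comp o G -> comp o (fun a => F [G a]).
Proof.
intros [f Hf] [g Hg]. exists (CComp f [g]). intros a.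
apply ev_comp with [G a]; [|apply Hf]. repeat constructor. apply Hg.
Qed.

Lemma comp_succ F : comp o F -> comp o (fun a => S (F a)).
Proof.
intros H. apply (comp_app1 (fun a => S (hd 0 a)) F); [|exact H].
exists CSucc. constructor.
Qed.

Lemma comp_const k : comp o (fun _ => k).
Proof.
induction k as [|k IH]; [exists CZero; constructor | apply comp_succ, IH].
Qed.

Lemma comp_oracle F : comp o F -> comp o (fun a => o (F a)).
Proof.
intros H. apply (comp_app1 (fun a => o (hd 0 a)) F); [|exact H].
exists COracle. constructor.
Qed.

(** The one recursion scheme, with two carried parameters. [ifz], [par], [half] and [shift] are
    written with [nat_rect] so that it applies to them by conversion. *)
Lemma comp_rec N A B F G :
  comp o N -> comp o A -> comp o B -> comp o F -> comp o G ->
  comp o (fun a => nat_rect (fun _ => nat) (F [A a; B a])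
                     (fun k r => G [k; r; A a; B a]) (N a)).
Proof.
intros [n Hn] [a' Ha] [b' Hb] [f Hf] [g Hg].
exists (CComp (CPrim f g) [n; a'; b']). intros a.
apply ev_comp with [N a; A a; B a].
- repeat constructor; auto.
- induction (N a) as [|k IH]; simpl.
  + constructor. apply Hf.
  + apply ev_primS with (1 := IH). apply Hg.
Qed.

Definition ifz (x a b : nat) : nat := nat_rect (fun _ => nat) a (fun _ _ => b) x.

Lemma comp_ifz X A B : comp o X -> comp o A -> comp o B ->
  comp o (fun a => ifz (X a) (A a) (B a)).
Proof.
intros HX HA HB.
apply (comp_rec X A B (fun a => nth 0 a 0) (fun a => nth 3 a 0));
  auto using comp_proj.
Qed.

Lemma comp_add X Y : comp o X -> comp o Y -> comp o (fun a => X a + Y a).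
Proof.
intros HX HY.
eapply comp_ext; [|apply (comp_rec X Y Y (fun a => nth 0 a 0) (fun a => S (nth 1 a 0)));
  auto using comp_proj, comp_succ].
intros a. simpl. induction (X a); simpl; auto.
Qed.

Lemma comp_pred X : comp o X -> comp o (fun a => pred (X a)).
Proof.
intros HX.
eapply comp_ext; [|apply (comp_rec X X X (fun a => 0) (fun a => nth 0 a 0));
  auto using comp_proj, comp_const].
intros a. simpl. destruct (X a); reflexivity.
Qed.

Lemma comp_sub X Y : comp o X -> comp o Y -> comp o (fun a => X a - Y a).
Proof.
intros HX HY.
eapply comp_ext; [|apply (comp_rec Y X X (fun a => nth 0 a 0) (fun a => pred (nth 1 a 0)));
  auto using comp_proj, comp_pred].
intros a. simpl. induction (Y a) as [|k IH]; simpl; lia.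
Qed.

(** The recursion produces the triangular number that Cantor pairing adds to the second
    coordinate. *)
Lemma comp_pair X Y : comp o X -> comp o Y -> comp o (fun a => Cantor.to_nat (X a, Y a)).
Proof.
intros HX HY. apply comp_add; [exact HY|].
apply (comp_rec (fun a => Y a + X a) X X (fun _ => 0) (fun a => S (nth 0 a 0) + nth 1 a 0));
  auto using comp_const, comp_add, comp_succ, comp_proj.
Qed.

Definition par (n : nat) : nat :=
  nat_rect (fun _ => nat) 0 (fun _ r => ifz r 1 0) n.

Definition half (n : nat) : nat :=
  nat_rect (fun _ => nat) 0 (fun k r => r + par k) n.

Definition shift (k T : nat) : nat :=
  nat_rect (fun _ => nat) T (fun _ r => half r) k.

Lemma comp_par X : comp o X -> comp o (fun a => par (X a)).
Proof.
intros HX.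
apply (comp_rec X X X (fun _ => 0) (fun a => ifz (nth 1 a 0) 1 0));
  auto using comp_const, comp_ifz, comp_proj.
Qed.

Lemma comp_half X : comp o X -> comp o (fun a => half (X a)).
Proof.
intros HX.
apply (comp_rec X X X (fun _ => 0) (fun a => nth 1 a 0 + par (nth 0 a 0)));
  auto using comp_const, comp_add, comp_par, comp_proj.
Qed.

Lemma comp_shift X Y : comp o X -> comp o Y -> comp o (fun a => shift (X a) (Y a)).
Proof.
intros HX HY.
apply (comp_rec X Y Y (fun a => nth 0 a 0) (fun a => half (nth 1 a 0)));
  auto using comp_half, comp_proj.
Qed.

Lemma half_par n : n = 2 * half n + par n /\ par n <= 1.
Proof.
induction n as [|n [IH1 IH2]]; [simpl; lia|].
change (half (S n)) with (half n + par n).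
change (par (S n)) with (ifz (par n) 1 0).
destruct (par n) as [|[|k]]; simpl in *; lia.
Qed.

(* [hist k] lists the decisions [greedy 0], ..., [greedy (k - 1)] in binary, the last one as
   the lowest bit, so that the bit [greedy (k - 1 - i)] is the parity of [shift i (hist k)]. *)
Section Greedy.
Variables (p : nat -> nat) (V : nat -> nat -> nat).

(** Digit [k] of [T] holds the decision on [n - 1 - k], hence the argument [n - S k] of [V]. *)
Definition compat (n T : nat) : nat :=
  nat_rect (fun _ => nat) 1
    (fun k r => ifz (par (shift k T)) r (ifz (V (n - S k) n) 0 r)) n.

Definition greedy_next (n T : nat) : nat := ifz (p n) 0 (compat n T).

Definition hist (n : nat) : nat :=
  nat_rect (fun _ => nat) 0 (fun k r => r + r + greedy_next k r) n.

Definition greedy (n : nat) : nat := greedy_next n (hist n).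

Hypotheses (Hp : comp o (fun a => p (nth 0 a 0)))
  (HV : comp o (fun a => V (nth 0 a 0) (nth 1 a 0))).

Lemma comp_app2 F X Y : comp o F -> comp o X -> comp o Y -> comp o (fun a => F [X a; Y a]).
Proof.
intros [f Hf] [x Hx] [y Hy]. exists (CComp f [x; y]). intros a.
apply ev_comp with [X a; Y a]; [|apply Hf]. repeat constructor; auto.
Qed.

Lemma comp_greedy_next X T : comp o X -> comp o T ->
  comp o (fun a => greedy_next (X a) (T a)).
Proof.
intros HX HT. apply comp_ifz; [|apply comp_const|].
- apply (comp_app1 (fun a => p (nth 0 a 0)) X); auto.
- apply (comp_rec X X T (fun _ => 1) (fun a =>
    ifz (par (shift (nth 0 a 0) (nth 3 a 0))) (nth 1 a 0)
      (ifz (V (nth 2 a 0 - S (nth 0 a 0)) (nth 2 a 0)) 0 (nth 1 a 0))));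
  auto using comp_const.
  apply comp_ifz; auto using comp_par, comp_shift, comp_proj.
  apply comp_ifz; auto using comp_const, comp_proj.
  apply (comp_app2 (fun a => V (nth 0 a 0) (nth 1 a 0))
    (fun a => nth 2 a 0 - S (nth 0 a 0)) (fun a => nth 2 a 0));
  auto using comp_sub, comp_succ, comp_proj.
Qed.

Lemma comp_greedy X : comp o X -> comp o (fun a => greedy (X a)).
Proof.
intros HX. apply comp_greedy_next; [exact HX|].
apply (comp_rec X X X (fun _ => 0)
  (fun a => nth 1 a 0 + nth 1 a 0 + greedy_next (nth 0 a 0) (nth 1 a 0)));
auto using comp_const, comp_add, comp_greedy_next, comp_proj.
Qed.
End Greedy.

End ComputableFunctions.

Section GreedySpec.
Variables (p : nat -> nat) (V : nat -> nat -> nat).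

Lemma compat_spec n T :
  (forall k, k < n -> par (shift k T) = 0 \/ V (n - S k) n <> 0) /\ compat V n T = 1 \/
  (exists k, k < n /\ par (shift k T) <> 0 /\ V (n - S k) n = 0) /\ compat V n T = 0.
Proof.
unfold compat.
assert (H : forall j,
  let r := nat_rect (fun _ => nat) 1
    (fun k r => ifz (par (shift k T)) r (ifz (V (n - S k) n) 0 r)) j in
  (forall k, k < j -> par (shift k T) = 0 \/ V (n - S k) n <> 0) /\ r = 1 \/
  (exists k, k < j /\ par (shift k T) <> 0 /\ V (n - S k) n = 0) /\ r = 0).
{ induction j as [|j IH]; simpl; [left; split; [intros; lia | reflexivity]|].
  destruct (par (shift j T)) eqn:Ep; [|destruct (V (n - S j) n) eqn:Ev]; simpl.
  - destruct IH as [[H1 H2]|[[k [H1 H2]] H3]].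
    + left. split; [|exact H2]. intros k Hk.
      destruct (Nat.eq_dec k j); [subst; auto | apply H1; lia].
    + right. split; [exists k; split; [lia|exact H2] | exact H3].
  - right. split; [|reflexivity]. exists j. rewrite Ep. repeat split; auto; lia.
  - destruct IH as [[H1 H2]|[[k [H1 H2]] H3]].
    + left. split; [|exact H2]. intros k Hk.
      destruct (Nat.eq_dec k j); [subst; right; lia | apply H1; lia].
    + right. split; [exists k; split; [lia|exact H2] | exact H3]. }
apply H.
Qed.

Lemma greedy_le1 n T : greedy_next p V n T <= 1.
Proof.
unfold greedy_next. destruct (p n); simpl; [lia|].
destruct (compat_spec n T) as [[_ ->]|[_ ->]]; lia.
Qed.

Lemma hist_bit n : forall k, k < n -> par (shift k (hist p V n)) = greedy p V (n - S k).
Proof.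
induction n as [|n IH]; intros k Hk; [lia|].
assert (Hh : half (hist p V (S n)) = hist p V n /\ par (hist p V (S n)) = greedy p V n).
{ pose proof (half_par (hist p V (S n))) as H. simpl in H.
  pose proof (greedy_le1 n (hist p V n)). unfold greedy. simpl. lia. }
destruct k as [|k].
- simpl shift. replace (S n - 1) with n by lia. apply Hh.
- assert (Hs : shift (S k) (hist p V (S n)) = shift k (half (hist p V (S n)))).
  { clear. induction k as [|k IH]; [reflexivity|].
    change (shift (S (S k)) (hist p V (S n))) with (half (shift (S k) (hist p V (S n)))).
    rewrite IH. reflexivity. }
  rewrite Hs, (proj1 Hh), IH by lia. reflexivity.
Qed.

(** By [hist_bit] the digits are the earlier decisions, so the coding disappears; this is the form
    in which the greedy set is used. *)
Lemma greedy_iff n : greedy p V n = 1 <->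
  p n <> 0 /\ forall m, m < n -> greedy p V m = 1 -> V m n <> 0.
Proof.
assert (Hb : forall m, m < n -> par (shift (n - S m) (hist p V n)) = greedy p V m).
{ intros m Hm. rewrite hist_bit by lia. f_equal. lia. }
unfold greedy at 1, greedy_next. destruct (p n) as [|x]; simpl.
{ split; [discriminate | intros [H _]; congruence]. }
destruct (compat_spec n (hist p V n)) as [[H ->]|[[k [H1 [H2 H3]]] ->]].
- split; [|reflexivity]. intros _. split; [discriminate|]. intros m Hm Hg.
  destruct (H (n - S m)) as [H0|H0]; [lia|rewrite Hb in H0 by lia; lia|].
  replace (n - S (n - S m)) with m in H0 by lia. exact H0.
- split; [discriminate|]. intros [_ H]. exfalso.
  apply (H (n - S k)); [lia| |exact H3].
  rewrite hist_bit in H2 by lia.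
  pose proof (greedy_le1 (n - S k) (hist p V (n - S k))). unfold greedy in *. lia.
Qed.
End GreedySpec.

Lemma ojoin_even o1 o2 x : ojoin o1 o2 (x + x) = o1 x.
Proof.
replace (x + x) with (2 * x) by lia. unfold ojoin.
rewrite Nat.odd_even, Nat.div2_double. reflexivity.
Qed.

Lemma ojoin_odd o1 o2 x : ojoin o1 o2 (S (x + x)) = o2 x.
Proof.
replace (x + x) with (2 * x) by lia. unfold ojoin.
rewrite Nat.odd_succ, Nat.even_even, Nat.div2_succ_double. reflexivity.
Qed.

Lemma col_oracle_pair f x y :
  x < y -> col_oracle f (Cantor.to_nat (x, y)) = if f x y then 1 else 0.
Proof.
intros H. unfold col_oracle. rewrite Cantor.cancel_of_to.
apply Nat.ltb_lt in H. rewrite H. reflexivity.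
Qed.

(** The code of a pair is at least the sum of its coordinates, so the first [N] oracle values
    involve only pairs below [N]. *)
Lemma col_oracle_agree f g N :
  (forall x y, x < y -> y < N -> f x y = g x y) ->
  forall i, i < N -> col_oracle f i = col_oracle g i.
Proof.
intros H i Hi. unfold col_oracle.
destruct (Cantor.of_nat i) as [x y] eqn:E.
assert (Hy : y + x <= i).
{ rewrite <- (Cantor.cancel_to_of i), E. apply Cantor.to_nat_non_decreasing. }
destruct (Nat.ltb_spec x y); [|reflexivity].
rewrite H by lia. reflexivity.
Qed.

(* A greedy set [S] inside [P] is even homogeneous for [f'], and [join S S] is then
   p-homogeneous. *)
Lemma computable_p_homogeneous f f' P c :
  Tred (col_oracle f') (col_oracle f) ->
  infinite P ->
  (forall z, P z = true -> exists N, forall u, N <= u -> z < u -> f' z u = c) ->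
  exists H, p_homogeneous f' H /\
    computable_in H (ojoin (col_oracle f) (set_oracle P)).
Proof.
intros [e He] Pinf Plim.
set (o := ojoin (col_oracle f) (set_oracle P)).
assert (Hf : comp o (fun a => col_oracle f (hd 0 a))).
{ apply comp_ext with (fun a => o (nth 0 a 0 + nth 0 a 0)).
  - intros a. unfold o. rewrite ojoin_even. destruct a; reflexivity.
  - auto using comp_oracle, comp_add, comp_proj. }
assert (Hp : comp o (fun a => set_oracle P (nth 0 a 0))).
{ apply comp_ext with (fun a => o (S (nth 0 a 0 + nth 0 a 0))).
  - intros a. unfold o. apply ojoin_odd.
  - auto using comp_oracle, comp_succ, comp_add, comp_proj. }
(* For [m < n], [V m n] is nonzero exactly when [f' m n = c]; for [c = false] the bit is
   complemented. *)
set (V := fun m n => let v := col_oracle f' (Cantor.to_nat (m, n)) in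
                     if c then v else 1 - v).
assert (HV : comp o (fun a => V (nth 0 a 0) (nth 1 a 0))).
{ assert (Hv : comp o (fun a =>
    col_oracle f' (Cantor.to_nat (nth 0 a 0, nth 1 a 0)))).
  { destruct (comp_pair o _ _ (comp_proj o 0) (comp_proj o 1)) as [c1 Hc1].
    exists (CComp (subst_oracle (proj1_sig (constructive_indefinite_description _ Hf)) e) [c1]).
    intros a. apply ev_comp with [Cantor.to_nat (nth 0 a 0, nth 1 a 0)].
    - repeat constructor. apply Hc1.
    - destruct (constructive_indefinite_description _ Hf) as [c0 Hc0]. simpl.
      apply eval_subst_oracle with (1 := Hc0), He. }
  unfold V. destruct c; [exact Hv|].
  apply comp_sub; [apply comp_const | exact Hv]. }
assert (HVc : forall m n, m < n -> (V m n <> 0 <-> f' m n = c)).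
{ intros m n Hmn. unfold V. rewrite col_oracle_pair by exact Hmn.
  destruct c, (f' m n); simpl; split; congruence. }
set (g := greedy (set_oracle P) V).
assert (Hg : forall n, g n = 1 <-> P n = true /\ forall m, m < n -> g m = 1 -> f' m n = c).
{ intros n. unfold g. rewrite greedy_iff.
  assert (HP : set_oracle P n <> 0 <-> P n = true).
  { unfold set_oracle. destruct (P n); split; congruence. }
  rewrite HP. split; intros [H1 H2]; split; auto; intros m Hm Hm1;
    apply HVc; auto. }
set (A := fun n => Nat.eqb (g n) 1).
assert (HA : forall n, A n = true <-> g n = 1) by (intros; apply Nat.eqb_eq).
(* If all selected points lay below [N], they would all have reached their limit [c] by some [M],
   and a point of [P] beyond both bounds would be selected too. *)
assert (Ainf : infinite A).
{ intros N.
  assert (HB : exists M, forall m, m < N -> g m = 1 -> forall u, M <= u -> m < u -> f' m u = c).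
  { clear -Plim Hg. induction N as [|N [M HM]]; [exists 0; intros; lia|].
    destruct (Nat.eq_dec (g N) 1) as [E|E].
    - destruct (Plim N) as [M' HM']; [apply Hg, E|].
      exists (max M M'). intros m Hm Hm1 u Hu.
      destruct (Nat.eq_dec m N); [subst; apply HM'; lia | apply HM; auto; lia].
    - exists M. intros m Hm Hm1. apply HM; auto.
      destruct (Nat.eq_dec m N); [congruence | lia]. }
  destruct HB as [M HM]. destruct (Pinf (max N M)) as [n [Hn HPn]].
  apply NNPP. intros Hno.
  assert (Hsmall : forall m, g m = 1 -> m < N).
  { intros m Hm. destruct (le_lt_dec N m); [|assumption].
    exfalso. apply Hno. exists m. split; [lia | apply HA, Hm]. }
  apply Hno. exists n. split; [lia|]. apply HA, Hg. split; [exact HPn|].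
  intros m Hm Hm1. apply HM; auto; lia. }
exists (join A A). split.
- exists A, A. split; [|reflexivity]. split; [exact Ainf|]. split; [exact Ainf|].
  exists c. intros x y Hx Hy Hxy. apply HA in Hx, Hy. unfold colsym.
  destruct (Nat.ltb_spec x y).
  + apply Hg; assumption.
  + apply Hg; try assumption. lia.
- destruct (comp_greedy o (set_oracle P) V Hp HV _ (comp_half o _ (comp_proj o 0)))
    as [c1 Hc1].
  exists c1. intros n. specialize (Hc1 [n]). simpl in Hc1.
  replace (set_oracle (join A A) n) with (greedy (set_oracle P) V (half n)); [exact Hc1|].
  assert (Hh : half n = Nat.div2 n).
  { pose proof (half_par n). pose proof (Nat.div2_odd n).
    destruct (Nat.odd n); simpl in *; lia. }
  rewrite Hh. fold g. unfold set_oracle, join.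
  pose proof (greedy_le1 (set_oracle P) V (Nat.div2 n) (hist (set_oracle P) V (Nat.div2 n))) as Hle.
  change (g (Nat.div2 n) <= 1) in Hle.
  replace (if Nat.odd n then A (Nat.div2 n) else A (Nat.div2 n)) with (A (Nat.div2 n))
    by (destruct (Nat.odd n); reflexivity).
  unfold A. destruct (Nat.eqb_spec (g (Nat.div2 n)) 1); lia.
Qed.

(** * Countability of the functionals *)

Fixpoint encode (e : code) : nat :=
  match e with
  | CZero => Cantor.to_nat (0, 0)
  | CSucc => Cantor.to_nat (1, 0)
  | CProj i => Cantor.to_nat (2, i)
  | COracle => Cantor.to_nat (3, 0)
  | CComp f gs => Cantor.to_nat (4, Cantor.to_nat (encode f,
      fold_right (fun g r => S (Cantor.to_nat (encode g, r))) 0 gs))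
  | CPrim f g => Cantor.to_nat (5, Cantor.to_nat (encode f, encode g))
  | CMu f => Cantor.to_nat (6, encode f)
  end.

Lemma to_nat_pair_inj a b c d :
  Cantor.to_nat (a, b) = Cantor.to_nat (c, d) -> a = c /\ b = d.
Proof. intros H. apply Cantor.to_nat_inj in H. inversion H. auto. Qed.

Fixpoint encode_inj (e e' : code) {struct e} : encode e = encode e' -> e = e'.
Proof.
destruct e as [| |i| |f gs|f g|f], e' as [| |i'| |f' gs'|f' g'|f'];
  cbn [encode]; intros H; apply to_nat_pair_inj in H; destruct H as [H1 H2];
  try discriminate H1; try reflexivity.
- congruence.
- apply to_nat_pair_inj in H2. destruct H2 as [H2 H3].
  apply encode_inj in H2. subst. f_equal. clear H1.
  revert gs' H3. induction gs as [|g gs IH]; intros [|g' gs'] H3; cbn [fold_right] in H3;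
    try discriminate H3; [reflexivity|].
  apply Nat.succ_inj, to_nat_pair_inj in H3. destruct H3 as [H3 H4].
  f_equal; [apply encode_inj; exact H3 | apply IH; exact H4].
- apply to_nat_pair_inj in H2. destruct H2 as [H2 H3]. f_equal; apply encode_inj; assumption.
- f_equal. apply encode_inj. assumption.
Qed.

Lemma code_enum : exists en : nat -> code, forall e, exists n, en n = e.
Proof.
exists (fun n => epsilon (inhabits CZero) (fun e => encode e = n)).
intros e. exists (encode e). apply encode_inj.
apply (epsilon_spec (inhabits CZero) (fun e' => encode e' = encode e)). eauto.
Qed.

(** * Thinning reservoirs *)

(** The index in [R] lets the [n]th step serve the [n]th task. *)
Lemma dependent_choice {T : Type} (I : T -> Prop) (R : nat -> T -> T -> Prop) t0 :
  I t0 -> (forall n t, I t -> exists t', I t' /\ R n t t') ->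
  exists s, s 0 = t0 /\ forall n, I (s n) /\ R n (s n) (s (S n)).
Proof.
intros H0 H.
assert (H' : forall n (t : {t | I t}), exists t' : {t | I t}, R n (proj1_sig t) (proj1_sig t')).
{ intros n [t Ht]. destruct (H n t Ht) as [t' [Ht' Hr]]. exists (exist _ t' Ht'). exact Hr. }
set (next := fun n t => proj1_sig (constructive_indefinite_description _ (H' n t))).
set (s := fun n => nat_rect (fun _ => {t | I t}) (exist _ t0 H0) next n).
exists (fun n => proj1_sig (s n)). split; [reflexivity|].
intros n. split; [exact (proj2_sig (s n))|].
exact (proj2_sig (constructive_indefinite_description _ (H' n (s n)))).
Qed.

Definition inc (h : nat -> nat) : Prop := forall i, h i < h (S i).

Lemma inc_lt h i j : inc h -> i < j -> h i < h j.
Proof.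
intros H Hij. induction Hij as [|j Hij IH]; [apply H|]. specialize (H j). lia.
Qed.

Lemma inc_lt_inv h i j : inc h -> h i < h j -> i < j.
Proof.
intros H Hij. destruct (le_lt_dec j i) as [Hji|]; [|assumption].
destruct (Nat.eq_dec i j) as [->|]; [lia|].
pose proof (inc_lt h j i H ltac:(lia)). lia.
Qed.

Lemma inc_inj h i j : inc h -> h i = h j -> i = j.
Proof.
intros H E. destruct (Nat.lt_trichotomy i j) as [L|[L|L]]; [|exact L|];
  apply (inc_lt h _ _ H) in L; lia.
Qed.

Lemma inc_ge h i : inc h -> i <= h i.
Proof. intros H. induction i as [|i IH]; [lia|]. specialize (H i). lia. Qed.

Definition Inf (Y : nat -> Prop) : Prop := forall n, exists m, n <= m /\ Y m.

(* [res Z Y]: the reservoir [Z] refines [Y]. *)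
Definition res (Z Y : nat -> Prop) : Prop := Inf Z /\ forall z, Z z -> Y z.

Lemma res_trans X Y Z : res X Y -> res Y Z -> res X Z.
Proof. intros [H1 H2] [H3 H4]. split; auto. Qed.

Lemma res_refl Y : Inf Y -> res Y Y.
Proof. split; auto. Qed.

Lemma res_ge Y m : Inf Y -> res (fun z => Y z /\ m <= z) Y.
Proof.
intros H. split; [|tauto]. intros n. destruct (H (max n m)) as [k [Hk HY]].
exists k. repeat split; [lia | exact HY | lia].
Qed.

Lemma inc_range_Inf w : inc w -> Inf (fun u => exists j, u = w j).
Proof. intros H n. exists (w n). split; [apply inc_ge, H | eauto]. Qed.

Section Diagonal.
Variables (Y : nat -> Prop) (R : nat -> nat -> (nat -> Prop) -> Prop).
Hypothesis Rher : forall z x Z Z', R z x Z -> res Z' Z -> R z x Z'.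

(** Diagonal intersection: each element is taken from the previous reservoir and the reservoirs
    shrink, so all later elements lie in the reservoir obtained with [w i]; heredity of [R] then
    passes to the set of later elements. *)
Lemma diagonal m0 : Inf Y ->
  (forall Y' m, res Y' Y -> exists z x Z,
     Y' z /\ m <= z /\ m <= x /\ res Z Y' /\ R z x Z) ->
  exists w v, inc w /\ inc v /\ forall i, m0 <= w i /\ m0 <= v i /\ Y (w i) /\
    R (w i) (v i) (fun u => exists j, i < j /\ u = w j).
Proof.
intros HY step.
destruct (step Y m0) as [z0 [x0 [Z0 [H1 [H2 [H3 [H4 H5]]]]]]]; [apply res_refl, HY|].
destruct (dependent_choice
  (fun t : nat * nat * (nat -> Prop) => let '(z, x, Z) := t in
     m0 <= z /\ m0 <= x /\ Y z /\ res Z Y /\ R z x Z)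
  (fun _ t t' => let '(z, x, Z) := t in let '(z', x', Z') := t' in
     z < z' /\ x < x' /\ Z z' /\ res Z' Z) (z0, x0, Z0)) as [s [_ Hs]].
- auto.
- intros _ [[z x] Z] [G1 [G2 [G3 [G4 G5]]]].
  destruct (step Z (S (max z x)) G4) as [z' [x' [Z' [K1 [K2 [K3 [K4 K5]]]]]]].
  exists (z', x', Z'). split; [|repeat split; auto; try lia; apply K4].
  split; [lia|]. split; [lia|]. split; [apply G4, K1|].
  split; [eapply res_trans; eassumption | exact K5].
- set (w := fun i => fst (fst (s i))). set (v := fun i => snd (fst (s i))).
  set (Z := fun i => snd (s i)).
  assert (Hs' : forall i, (m0 <= w i /\ m0 <= v i /\ Y (w i) /\ res (Z i) Y /\
     R (w i) (v i) (Z i)) /\ w i < w (S i) /\ v i < v (S i) /\ Z i (w (S i)) /\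
     res (Z (S i)) (Z i)).
  { intros i. specialize (Hs i). unfold w, v, Z.
    destruct (s i) as [[? ?] ?], (s (S i)) as [[? ?] ?]. exact Hs. }
  clearbody w v Z. clear Hs s.
  assert (Hw : inc w) by (intros i; apply Hs').
  exists w, v. split; [exact Hw|]. split; [intros i; apply Hs'|].
  intros i. destruct (Hs' i) as [[G1 [G2 [G3 [G4 G5]]]] _]. repeat split; auto.
  apply Rher with (1 := G5). split.
  + intros n. exists (w (S i + n)). split; [pose proof (inc_ge w (S i + n) Hw); lia|].
    exists (S i + n). split; [lia | reflexivity].
  + intros u [j [Hj ->]].
    assert (HZ : forall k z, Z (i + k) z -> Z i z).
    { induction k as [|k IH]; intros z Hz; [rewrite Nat.add_0_r in Hz; exact Hz|].
      apply IH. rewrite Nat.add_succ_r in Hz. apply (Hs' (i + k)), Hz. }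
    apply (HZ (j - S i)). destruct j as [|j]; [lia|].
    replace (i + (S j - S i)) with j by lia. exact (proj1 (proj2 (proj2 (proj2 (Hs' j))))).
Qed.
End Diagonal.

Section Fusion.
Variables (Y : nat -> Prop) (K : list nat -> (nat -> Prop) -> Prop).
Hypothesis Kher : forall F Z Z', K F Z -> res Z' Z -> K F Z'.
Hypothesis Kstep : forall F Z, res Z Y -> K F Z ->
  exists Z', res Z' Z /\ forall z, Z' z -> K (F ++ [z]) Z'.

(** Finitely many stems are treated in turn; by heredity, later shrinkings do no harm to earlier
    ones. *)
Lemma fusion_shrink Ls Z : res Z Y -> (forall F, In F Ls -> K F Z) ->
  exists Z', res Z' Z /\ forall F z, In F Ls -> Z' z -> K (F ++ [z]) Z'.
Proof.
induction Ls as [|F0 Ls IH]; intros HZ HK.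
- exists Z. split; [apply res_refl, HZ | intros ? ? []].
- destruct IH as [Z1 [H1 H2]]; [exact HZ | intros; apply HK; right; assumption|].
  destruct (Kstep F0 Z1) as [Z2 [H3 H4]].
  + eapply res_trans; eassumption.
  + apply Kher with Z; [apply HK; left; reflexivity | exact H1].
  + exists Z2. split; [eapply res_trans; eassumption|].
    intros F z [<-|HF] Hz; [auto|].
    apply Kher with Z1; [apply H2; [exact HF | apply H3, Hz] | exact H3].
Qed.

Lemma fusion : Inf Y -> K [] Y ->
  exists w, inc w /\ (forall i, Y (w i)) /\
    forall h, inc h -> (forall i, exists k, h i = w k) ->
    forall j, exists Z, Inf Z /\ K (map h (seq 0 j)) Z.
Proof.
intros HY HK.
(* In a state, [Ls] collects all increasing lists of elements chosen so far, and [Z] is a reservoir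
   serving all of them. *)
destruct (dependent_choice
  (fun t : nat * list (list nat) * (nat -> Prop) => let '(_, Ls, Z) := t in
     res Z Y /\ In [] Ls /\ forall F, In F Ls -> K F Z)
  (fun _ t t' => let '(w, Ls, Z) := t in let '(w', Ls', _) := t' in
     w < w' /\ Y w' /\ Ls' = Ls ++ map (fun F => F ++ [w']) Ls)
  (0, [[]], Y)) as [s [_ Hs]].
- repeat split; auto; [left; reflexivity | intros F [<-|[]]; exact HK].
- intros _ [[w Ls] Z] [H1 [H0 H2]].
  destruct (fusion_shrink Ls Z H1 H2) as [Z' [H3 H4]].
  destruct (proj1 H3 (S w)) as [w' [H5 H6]].
  exists (w', Ls ++ map (fun F => F ++ [w']) Ls, Z'). repeat split; auto.
  + apply H3.
  + intros z Hz. apply H1, H3, Hz.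
  + apply in_or_app. left. exact H0.
  + intros F HF. apply in_app_or in HF. destruct HF as [HF|HF].
    * apply Kher with Z; auto.
    * apply in_map_iff in HF. destruct HF as [F' [<- HF']]. auto.
  + apply H1, H3, H6.
(* The first component of the initial state is a dummy, hence the shift by one. *)
- set (w := fun i => fst (fst (s (S i)))). set (Ls := fun i => snd (fst (s i))).
  set (Z := fun i => snd (s i)).
  assert (Hs' : forall i, (res (Z i) Y /\ In [] (Ls i) /\ forall F, In F (Ls i) -> K F (Z i)) /\
     w i < w (S i) /\ Y (w i) /\ Ls (S i) = Ls i ++ map (fun F => F ++ [w i]) (Ls i)).
  { intros i. pose proof (Hs i) as Hi. pose proof (Hs (S i)) as Hi'. unfold w, Ls, Z.
    destruct (s i) as [[? ?] ?], (s (S i)) as [[? ?] ?], (s (S (S i))) as [[? ?] ?]. tauto. }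
  clearbody w Ls Z. clear Hs s.
  assert (Hw : inc w) by (intros i; apply Hs').
  exists w. split; [exact Hw|]. split; [intros i; apply Hs'|].
  intros h Hh Hr.
  assert (Hmono : forall i k F, In F (Ls i) -> In F (Ls (i + k))).
  { intros i k F HF. induction k as [|k IH]; [rewrite Nat.add_0_r; exact HF|].
    rewrite Nat.add_succ_r. replace (Ls (S (i + k))) with
      (Ls (i + k) ++ map (fun F => F ++ [w (i + k)]) (Ls (i + k))) by (symmetry; apply Hs').
    apply in_or_app. left. exact IH. }
  assert (HL : forall j i, (forall j', j' < j -> h j' < w i) -> In (map h (seq 0 j)) (Ls i)).
  { induction j as [|j IH]; intros i Hi; [apply Hs'|].
    rewrite seq_S, map_app. simpl. destruct (Hr j) as [k Hk]. rewrite Hk.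
    assert (Hki : k < i).
    { apply (inc_lt_inv w); [exact Hw|]. rewrite <- Hk. apply Hi. lia. }
    replace i with (S k + (i - S k)) by lia. apply Hmono.
    replace (Ls (S k)) with (Ls k ++ map (fun F => F ++ [w k]) (Ls k)) by (symmetry; apply Hs').
    apply in_or_app. right. apply (in_map (fun F => F ++ [w k])), IH.
    intros j' Hj'. rewrite <- Hk. apply inc_lt; assumption. }
  intros j. exists (Z (S (h j))). split; [apply Hs'|]. apply Hs', HL.
  intros j' Hj'. pose proof (inc_lt h j' j Hh Hj'). pose proof (inc_ge w (S (h j)) Hw). lia.
Qed.
End Fusion.

(** * Conditions *)

(* A finite coloring of the pairs below [len] together with promises for the limits of some of
   the points below [len]; [lock q x] is meaningless for [x >= len q]. *)
Record cond := Cond { len : nat; col : coloring; lock : nat -> option bool }.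

Definition agree (f : coloring) (q : cond) : Prop :=
  forall x y, x < y -> y < len q -> f x y = col q x y.

Definition obeys (f : coloring) (q : cond) : Prop :=
  agree f q /\
  forall x b y, x < len q -> lock q x = Some b -> len q <= y -> f x y = b.

(** A later condition may also lock old points that were still free. *)
Definition ext (r q : cond) : Prop :=
  len q <= len r /\ agree (col r) q /\
  forall x b, x < len q -> lock q x = Some b ->
    lock r x = Some b /\ forall y, len q <= y < len r -> col r x y = b.

(** Extension by colors alone: a lock present afterwards was there before, which makes it possible
    to trace locks back. *)
Definition ext_nolock (r q : cond) : Prop :=
  ext r q /\ (forall x, x < len q -> lock r x = lock q x) /\
  (forall x, len q <= x -> lock r x = None).

Lemma ext_refl q : ext q q.
Proof. repeat split; auto; intros; lia. Qed.

Lemma agree_ext f r q : ext r q -> agree f r -> agree f q.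
Proof.
intros [H1 [H2 H3]] H x y Hxy Hy. rewrite H by lia. apply H2; assumption.
Qed.

Lemma obeys_ext f r q : ext r q -> obeys f r -> obeys f q.
Proof.
intros Hr [H1 H2]. split; [eapply agree_ext; eassumption|].
destruct Hr as [G1 [G2 G3]]. intros x b y Hx Hb Hy.
destruct (G3 x b Hx Hb) as [G4 G5].
destruct (le_lt_dec (len r) y); [apply H2; auto; lia|].
rewrite H1 by lia. apply G5. lia.
Qed.

Lemma ext_trans p q r : ext p q -> ext q r -> ext p r.
Proof.
intros Hp [H1 [H2 H3]]. split; [destruct Hp; lia|].
split; [apply agree_ext with q; [split; auto|]; apply Hp|].
intros x b Hx Hb. destruct (H3 x b Hx Hb) as [H4 H5].
destruct Hp as [G1 [G2 G3]]. destruct (G3 x b) as [G4 G5]; [lia | exact H4|].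
split; [exact G4|]. intros y Hy. destruct (le_lt_dec (len q) y).
- apply G5. lia.
- rewrite G2 by lia. apply H5. lia.
Qed.

Lemma ext_nolock_trans p q r : ext_nolock p q -> ext_nolock q r -> ext_nolock p r.
Proof.
intros [H1 [H2 H3]] [G1 [G2 G3]]. split; [eapply ext_trans; eassumption|].
assert (len r <= len q) by apply G1.
split; intros x Hx.
- rewrite H2 by lia. apply G2, Hx.
- destruct (le_lt_dec (len q) x); [auto | rewrite H2 by lia; auto].
Qed.

Definition restrict (f : coloring) (q : cond) (m : nat) : cond :=
  Cond m f (fun x => if x <? len q then lock q x else None).

Lemma restrict_ext f q m : obeys f q -> len q <= m -> ext_nolock (restrict f q m) q.
Proof.
intros [H1 H2] Hm. repeat split; simpl; auto.
- destruct (Nat.ltb_spec x (len q)); [assumption | lia].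
- intros y Hy. apply H2 with (1 := H); [assumption | lia].
- intros x Hx. destruct (Nat.ltb_spec x (len q)); [reflexivity | lia].
- intros x Hx. destruct (Nat.ltb_spec x (len q)); [lia | reflexivity].
Qed.

Lemma obeys_exists q : exists f, obeys f q.
Proof.
exists (fun x y => if y <? len q then col q x y else
                   match lock q x with Some b => b | None => false end).
split.
- intros x y Hxy Hy. apply Nat.ltb_lt in Hy. rewrite Hy. reflexivity.
- intros x b y Hx Hb Hy. apply Nat.ltb_ge in Hy. rewrite Hy, Hb. reflexivity.
Qed.

Lemma ext_nolock_len q m : exists r, ext_nolock r q /\ m <= len r.
Proof.
destruct (obeys_exists q) as [f Hf]. exists (restrict f q (max m (len q))).
split; [apply restrict_ext; [exact Hf | lia] | simpl; lia].
Qed.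

Definition setlock (q : cond) (x : nat) (b : bool) : cond :=
  Cond (len q) (col q) (fun y => if y =? x then Some b else lock q y).

(** Only the locks of the older condition [p] bind: the result extends [p] even if [q] locked [x] to
    the other color. This is what allows a lock to be reversed. *)
Lemma setlock_ext q p x b : ext q p ->
  (forall b', x < len p -> lock p x = Some b' -> b' = b) -> ext (setlock q x b) p.
Proof.
intros [H1 [H2 H3]] Hx. split; [exact H1|]. split; [exact H2|].
intros y b' Hy Hb. destruct (H3 y b' Hy Hb) as [H4 H5]. split; [|exact H5].
simpl. destruct (Nat.eqb_spec y x) as [->|]; [|exact H4].
f_equal. symmetry. apply Hx; assumption.
Qed.

Lemma lock_to q x b : (x < len q -> lock q x <> Some (negb b)) ->
  exists r, ext r q /\ x < len r /\ lock r x = Some b /\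
    forall y, y <> x -> len q <= y -> lock r y = None.
Proof.
intros Hx. destruct (ext_nolock_len q (S x)) as [r [[H1 [H2 H3]] H4]].
exists (setlock r x b). repeat split; simpl; auto.
- apply H1.
- apply H1.
- destruct (Nat.eqb_spec x0 x) as [->|]; [|apply H1; assumption].
  f_equal. specialize (Hx H). destruct b, b0; simpl in *; congruence.
- intros y Hy. destruct H1 as [_ [_ H1]]. apply (H1 x0 b0); assumption.
- rewrite Nat.eqb_refl. reflexivity.
- intros y Hy Hl. destruct (Nat.eqb_spec y x); [contradiction | auto].
Qed.

(** * Values and limits of [f'] under a condition, and legitimate stems *)

Section Functional.
Variable e : code.

Definition Gam (f : coloring) (z u : nat) (b : bool) : Prop :=
  eval (col_oracle f) e [Cantor.to_nat (z, u)] (if b then 1 else 0).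

(** With [agree] in place of [obeys], a decided value depends on the finite coloring alone and
    survives a change of locks, unlike [Settles]. *)
Definition Dec (q : cond) (z u : nat) (b : bool) : Prop :=
  forall f, agree f q -> Gam f z u b.

Definition Settles (q : cond) (z : nat) (c : bool) : Prop :=
  forall f u, obeys f q -> len q <= u -> z < u -> ~ Gam f z u (negb c).

(** If this fails, some extension excludes every value at a pair or prevents a point from being
    settled, and [f'] is kept from being a stable coloring. *)
Definition Good (q : cond) : Prop :=
  forall r, ext r q ->
    (forall z u, z < u -> exists f b, obeys f r /\ Gam f z u b) /\
    (forall z, exists r' c, ext r' r /\ Settles r' z c).

(** Failure yields an extension and an infinite reservoir none of whose elements can be settled to
    some color [c]; the members of the family in the theorem arise in this way. *)
Definition NP (q : cond) (X : nat -> Prop) : Prop :=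
  forall r c Y, ext r q -> res Y X -> exists z r', Y z /\ ext r' r /\ Settles r' z c.

Lemma Gam_det f z u b b' : Gam f z u b -> Gam f z u b' -> b = b'.
Proof.
intros H H'. pose proof (eval_det _ _ _ _ _ H H') as E.
destruct b, b'; simpl in E; congruence.
Qed.

(** By the use principle a long enough initial segment of [f] decides the value, without new
    locks. *)
Lemma Dec_intro f q z u b M : obeys f q -> Gam f z u b ->
  exists r, ext_nolock r q /\ M <= len r /\ obeys f r /\ Dec r z u b.
Proof.
intros Hf H. apply eval_use in H. destruct H as [N HN].
exists (restrict f q (max (max N M) (len q))).
split; [apply restrict_ext; [exact Hf | lia]|]. split; [simpl; lia|]. split.
- split; [intros x y _ _; reflexivity|]. simpl. intros x b' y Hx Hb Hy.
  destruct (Nat.ltb_spec x (len q)); [|discriminate].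
  apply (proj2 Hf x b' y); [assumption.. | lia].
- intros g Hg. apply HN. intros i Hi. apply col_oracle_agree with N; [|exact Hi].
  intros x y Hxy Hy. apply Hg; [exact Hxy | simpl; lia].
Qed.

Lemma Dec_ext r q z u b : ext r q -> Dec q z u b -> Dec r z u b.
Proof. intros Hr H f Hf. apply H. eapply agree_ext; eassumption. Qed.

Lemma Settles_ext r q z c : ext r q -> Settles q z c -> Settles r z c.
Proof.
intros Hr H f u Hf Hu. apply H; [eapply obeys_ext; eassumption|].
destruct Hr. lia.
Qed.

Lemma Good_ext r q : ext r q -> Good q -> Good r.
Proof. intros Hr H p Hp. apply H. eapply ext_trans; eassumption. Qed.

Lemma NP_ext r q X Y : ext r q -> res Y X -> NP q X -> NP r Y.
Proof.
intros Hr HY H p c Z Hp HZ. apply H; [eapply ext_trans | eapply res_trans]; eassumption.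
Qed.

(** [Good] supplies some value and the hypothesis excludes the wrong one; each decision only
    lengthens the coloring. *)
Lemma Dec_all q c z L : Good q ->
  (forall w, In w L -> w < z /\ forall f, obeys f q -> ~ Gam f w z (negb c)) ->
  forall M, exists r, ext_nolock r q /\ M <= len r /\ forall w, In w L -> Dec r w z c.
Proof.
intros HG HL M. induction L as [|w L IH].
- destruct (ext_nolock_len q M) as [r [H1 H2]]. exists r.
  repeat split; try apply H1; auto. intros w [].
- destruct IH as [r [H1 [H2 H3]]]; [intros; apply HL; right; assumption|].
  destruct (HL w) as [H4 H5]; [left; reflexivity|].
  destruct (proj1 (HG r (proj1 H1)) w z H4) as [f [b [H6 H7]]].
  assert (b = c) as ->.
  { destruct (Bool.bool_dec b c) as [|Hb]; [assumption|]. exfalso.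
    apply (H5 f); [apply obeys_ext with (2 := H6), H1|].
    replace (negb c) with b by (destruct b, c; simpl; congruence). exact H7. }
  destruct (Dec_intro f r w z c M H6 H7) as [s [G1 [G2 [_ G4]]]].
  exists s. split; [eapply ext_nolock_trans; eassumption|]. split; [exact G2|].
  intros w' [<-|Hw']; [exact G4|]. apply Dec_ext with r; [apply G1 | auto].
Qed.

Lemma Settles_all q c L :
  (forall w, In w L -> forall r, ext r q -> exists r', ext r' r /\ Settles r' w c) ->
  exists r, ext r q /\ forall w, In w L -> Settles r w c.
Proof.
induction L as [|w L IH]; intros HL.
- exists q. split; [apply ext_refl | intros w []].
- destruct IH as [r [H1 H2]]; [intros; apply HL; auto; right; assumption|].
  destruct (HL w (or_introl eq_refl) r H1) as [s [H3 H4]].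
  exists s. split; [eapply ext_trans; eassumption|].
  intros w' [<-|Hw']; [exact H4|]. eapply Settles_ext; eauto.
Qed.

(* [S] lists the first elements of a set [h 0 < h 1 < ...]; the elements of even index form the
   left half and those of odd index the right half of a p-homogeneous set of color [c]. *)
Definition Legit (c : bool) (q : cond) (S : list nat) : Prop :=
  (forall i j, i < j < length S -> nth i S 0 < nth j S 0) /\
  (forall z, In z S -> z < len q /\ Settles q z c) /\
  (forall i j, i < j < length S -> Nat.odd (j - i) = true ->
     Dec q (nth i S 0) (nth j S 0) c).

Lemma Legit_ext c r q S : ext r q -> Legit c q S -> Legit c r S.
Proof.
intros Hr [H1 [H2 H3]]. split; [exact H1|]. split.
- intros z Hz. destruct (H2 z Hz) as [H4 H5].
  split; [destruct Hr; lia | eapply Settles_ext; eassumption].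
- intros i j Hij Ho. eapply Dec_ext; eauto.
Qed.

Lemma Legit_snoc c q S z :
  (forall i j, i < j < length S -> nth i S 0 < nth j S 0) ->
  (forall w, In w S -> w < z) ->
  (forall w, In w (S ++ [z]) -> w < len q /\ Settles q w c) ->
  (forall i j, i < j < length S -> Nat.odd (j - i) = true ->
     Dec q (nth i S 0) (nth j S 0) c) ->
  (forall i, i < length S -> Nat.odd (length S - i) = true -> Dec q (nth i S 0) z c) ->
  Legit c q (S ++ [z]).
Proof.
intros H1 H2 H3 H4 H5.
assert (Hl : length (S ++ [z]) = Datatypes.S (length S)) by (rewrite length_app; simpl; lia).
assert (Hn : forall j, j < Datatypes.S (length S) ->
  j < length S /\ nth j (S ++ [z]) 0 = nth j S 0 \/
  j = length S /\ nth j (S ++ [z]) 0 = z).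
{ intros j Hj. destruct (le_lt_dec (length S) j).
  - right. assert (j = length S) as -> by lia. split; [reflexivity|].
    rewrite app_nth2, Nat.sub_diag by lia. reflexivity.
  - left. split; [assumption | apply app_nth1; assumption]. }
split; [|split; [exact H3|]]; rewrite Hl; intros i j Hij.
- destruct (Hn i) as [[Hi ->]|[Hi _]]; [lia| |lia].
  destruct (Hn j) as [[Hj ->]|[Hj ->]]; [lia | apply H1; lia | apply H2, nth_In, Hi].
- intros Ho. destruct (Hn i) as [[Hi ->]|[Hi _]]; [lia| |lia].
  destruct (Hn j) as [[Hj ->]|[Hj ->]]; [lia | apply H4; auto; lia|].
  apply H5; [exact Hi | subst j; exact Ho].
Qed.

(** The members of [S] are settled in [r] and [z] is beyond [len r], so their values at [z] can only
    be [c]; it remains to decide them by adding colors. *)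
Lemma Legit_add c q r r' S z : Good q -> ext r q -> Legit c r S -> len r <= z ->
  ext r' r -> Settles r' z c ->
  exists s, ext_nolock s r' /\ Legit c s (S ++ [z]).
Proof.
intros HG Hr [H1 [H2 H3]] Hz Hr' Hs.
assert (HGr : Good r') by (apply Good_ext with q; [eapply ext_trans; eassumption | exact HG]).
destruct (Dec_all r' c z S HGr) with (M := Datatypes.S z) as [s [G1 [G2 G3]]].
- intros w Hw. destruct (H2 w Hw) as [H4 H5]. split; [lia|].
  intros f Hf. apply H5; [eapply obeys_ext; eassumption | exact Hz | lia].
- exists s. split; [exact G1|].
  assert (Hsr : ext s r) by (apply ext_trans with r'; [apply G1 | exact Hr']).
  assert (Hl : len r <= len s) by apply Hsr.
  apply Legit_snoc; auto.
  + intros w Hw. destruct (H2 w Hw). lia.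
  + intros w Hw. apply in_app_or in Hw. destruct Hw as [Hw|[<-|[]]].
    * destruct (H2 w Hw). split; [lia | eapply Settles_ext; eassumption].
    * split; [lia | apply Settles_ext with r'; [apply G1 | exact Hs]].
  + intros i j Hij Ho. eapply Dec_ext; eauto.
  + intros i Hi _. apply G3, nth_In, Hi.
Qed.
End Functional.

(** * One pair of requirements *)

(** Positions up to [x] suffice since an increasing [h] has [i <= h i]; thus membership of [x]
    depends on finitely many values of [h]. *)
Definition side (h : nat -> nat) (b : bool) : set_nat := fun x =>
  existsb (fun i => (h i =? x) && eqb (Nat.even i) b) (seq 0 (S x)).

Definition Hset (h : nat -> nat) : set_nat := join (side h true) (side h false).

Lemma existsb_ext_in {T} (p p' : T -> bool) l :
  (forall i, In i l -> p i = p' i) -> existsb p l = existsb p' l.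
Proof.
induction l as [|i l IH]; intros H; simpl; [reflexivity|].
rewrite H, IH; [reflexivity | intros; apply H; right; assumption | left; reflexivity].
Qed.

Lemma side_agree h h' b x : (forall i, i <= x -> h i = h' i) -> side h b x = side h' b x.
Proof.
intros H. apply existsb_ext_in. intros i Hi. apply in_seq in Hi.
rewrite H by lia. reflexivity.
Qed.

Lemma Hset_agree h h' n : (forall i, i <= n -> h i = h' i) -> Hset h n = Hset h' n.
Proof.
intros H. unfold Hset, join. pose proof (Nat.div2_decr n n ltac:(lia)).
destruct (Nat.odd n); apply side_agree; intros; apply H; lia.
Qed.

Lemma eval_Hset_use h c a v : eval (set_oracle (Hset h)) c a v ->
  exists N, forall h', (forall i, i < N -> h' i = h i) -> eval (set_oracle (Hset h')) c a v.
Proof.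
intros H. apply eval_use in H. destruct H as [N HN]. exists N. intros h' Hh.
apply HN. intros i Hi. unfold set_oracle. rewrite (Hset_agree h' h); [reflexivity|].
intros j Hj. apply Hh. lia.
Qed.

(** The Mathias cylinder of stem [S] and reservoir [Y], its sets being given by their increasing
    enumerations. *)
Definition Cyl (S : list nat) (Y : nat -> Prop) (h : nat -> nat) : Prop :=
  inc h /\ (forall i, i < length S -> h i = nth i S 0) /\
  forall i, length S <= i -> Y (h i).

Definition extends (S S' : list nat) (X : nat -> Prop) : Prop :=
  exists F, S' = S ++ F /\ forall z, In z F -> X z.

Lemma extends_refl S X : extends S S X.
Proof. exists []. rewrite app_nil_r. split; [reflexivity | intros z []]. Qed.

Lemma extends_snoc S S' X z : extends S S' X -> X z -> extends S (S' ++ [z]) X.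
Proof.
intros [F [-> HF]] Hz. exists (F ++ [z]). rewrite app_assoc. split; [reflexivity|].
intros u Hu. apply in_app_or in Hu. destruct Hu as [Hu|[<-|[]]]; auto.
Qed.

Lemma extends_trans S S' S'' X Y :
  extends S S' X -> extends S' S'' Y -> (forall z, Y z -> X z) -> extends S S'' X.
Proof.
intros [F [-> HF]] [G [-> HG]] HXY. exists (F ++ G). rewrite app_assoc.
split; [reflexivity|]. intros z Hz. apply in_app_or in Hz. destruct Hz; auto.
Qed.

Lemma Cyl_extends S S' Y Y' h :
  extends S S' Y -> (forall z, Y' z -> Y z) -> Cyl S' Y' h -> Cyl S Y h.
Proof.
intros [F [-> HF]] HY [H1 [H2 H3]]. rewrite length_app in *.
split; [exact H1|]. split.
- intros i Hi. rewrite H2 by lia. apply app_nth1, Hi.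
- intros i Hi. destruct (le_lt_dec (length S + length F) i); [apply HY, H3; assumption|].
  rewrite H2 by assumption. rewrite app_nth2 by assumption. apply HF, nth_In. lia.
Qed.

Section Step.
Variables (e : code) (ec : bool -> code) (d : bool -> bool).

Definition Forced (c : bool) (S : list nat) (Y : nat -> Prop) (x : nat) : Prop :=
  forall h, Cyl S Y h -> eval (set_oracle (Hset h)) (ec c) [x] 1.

(** The color of the homogeneous set is guessed in advance as [d c]; every guess is a separate
    requirement later. *)
Definition Win (c : bool) (r : cond) (S : list nat) (Y : nat -> Prop) : Prop :=
  forall f h A, obeys f r -> Cyl S Y h ->
    (forall n, eval (set_oracle (Hset h)) (ec c) [n] (set_oracle A n)) -> infinite A ->
    ~ (forall x y, A x = true -> A y = true -> x < y -> f x y = d c).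

(** The bound [m] keeps both the new element and the forced output clear of existing locks. *)
Definition Active (c : bool) (S : list nat) (Y : nat -> Prop) : Prop :=
  forall Z m, res Z Y -> exists z x Z',
    Z z /\ m <= z /\ m <= x /\ res Z' Z /\ Forced c (S ++ [z]) Z' x.

(** The assumption to be refuted: neither of the two functionals can be defeated by a legitimate
    extension. *)
Definition Bad (q : cond) (E : bool -> list nat) (X : nat -> Prop) : Prop :=
  Good e q /\ NP e q X /\ Inf X /\ (forall c, Legit e c q (E c)) /\
  forall c r S Y, ext r q -> Legit e c r S -> extends (E c) S X -> res Y X -> ~ Win c r S Y.

Lemma Forced_sub c S S' Y Y' x : extends S S' Y -> (forall z, Y' z -> Y z) ->
  Forced c S Y x -> Forced c S' Y' x.
Proof. intros HS HY H h Hh. apply H. eapply Cyl_extends; eassumption. Qed.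

Lemma Active_res c S Y Y' : res Y' Y -> Active c S Y -> Active c S Y'.
Proof. intros HY H Z m HZ. apply H. eapply res_trans; eassumption. Qed.

Lemma Bad_ext q E X r E' Y : Bad q E X -> ext r q -> res Y X ->
  (forall c, Legit e c r (E' c)) -> (forall c, extends (E c) (E' c) X) -> Bad r E' Y.
Proof.
intros [H1 [H2 [H3 [H4 H5]]]] Hr HY HL HE. split; [eapply Good_ext; eassumption|].
split; [eapply NP_ext; eassumption|]. split; [apply HY|]. split; [exact HL|].
intros c r' S Y' Hr' HS Hex HY'. apply H5.
- eapply ext_trans; eassumption.
- exact HS.
- eapply extends_trans; [apply HE | exact Hex | apply HY].
- eapply res_trans; eassumption.
Qed.

Lemma computed_true h c A x :
  (forall n, eval (set_oracle (Hset h)) c [n] (set_oracle A n)) ->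
  (A x = true <-> eval (set_oracle (Hset h)) c [x] 1).
Proof.
intros H. split; intros Hx.
- specialize (H x). unfold set_oracle at 2 in H. rewrite Hx in H. exact H.
- pose proof (eval_det _ _ _ _ _ (H x) Hx) as E. unfold set_oracle in E.
  destruct (A x); [reflexivity | discriminate].
Qed.

(** * Consequences of never winning: forced outputs and locks *)

Section Base.
Variables (q : cond) (E : bool -> list nat) (X : nat -> Prop).
Hypothesis HB : Bad q E X.

(** Otherwise [x] could be locked to the opposite color; being output, it would have the wrong color
    with every large output, which is a win. *)
Lemma forced_locked c r S Y x : ext r q -> Legit e c r S -> extends (E c) S X ->
  res Y X -> Forced c S Y x -> x < len r /\ lock r x = Some (d c).
Proof.
intros Hr HS Hex HY HF. apply NNPP. intros Hno.
destruct (lock_to r x (negb (d c))) as [r' [H1 [H2 [H3 _]]]].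
{ rewrite negb_involutive. tauto. }
destruct HB as [_ [_ [_ [_ HW]]]].
apply (HW c r' S Y); [eapply ext_trans; eassumption | eapply Legit_ext; eassumption|
  exact Hex | exact HY|].
intros f h A Hf Hh HA Ainf Hhom.
assert (Ax : A x = true) by (apply (computed_true h (ec c)); auto).
destruct (Ainf (len r')) as [y [Hy Ay]].
assert (f x y = d c) by (apply Hhom; auto; lia).
rewrite (proj2 Hf x (negb (d c)) y) in H; auto. destruct (d c); discriminate.
Qed.

(** If no stem becomes active, fusion yields a reservoir whose stems never force an output beyond
    [len r0]. By the use principle the output set is then finite, which is a win. *)
Lemma active_exists c r0 S0 Y0 : ext r0 q -> Legit e c r0 S0 -> extends (E c) S0 X ->
  res Y0 X -> exists r S Y, ext r r0 /\ Legit e c r S /\ extends S0 S Y0 /\ res Y Y0 /\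
    Active c S Y.
Proof.
intros Hr0 HS0 Hex0 HY0. apply NNPP. intros Hno.
destruct HB as [HG [HN [_ [_ HW]]]].
set (K := fun F Z => (exists r, ext r r0 /\ Legit e c r (S0 ++ F)) /\
  (forall z, In z F -> Y0 z) /\
  forall Z' x, res Z' Z -> len r0 <= x -> ~ Forced c (S0 ++ F) Z' x).
destruct (fusion Y0 K) as [w [Hw [HwY Hfus]]].
- intros F Z Z' [H1 [H2 H3]] HZ. split; [exact H1|]. split; [exact H2|].
  intros Z'' x HZ''. apply H3. eapply res_trans; eassumption.
- intros F Z HZ [[r [Hr HL]] [HF Hund]]. apply NNPP. intros Hno'.
  assert (Hrq : ext r q) by (eapply ext_trans; eassumption).
  assert (HZX : res Z X) by (eapply res_trans; eassumption).
  assert (HexF : extends S0 (S0 ++ F) Y0) by (exists F; auto).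
  assert (H0 : forall Z2, res Z2 Z -> exists z x Z3, Z2 z /\ len r0 <= x /\ res Z3 Z2 /\
     Forced c ((S0 ++ F) ++ [z]) Z3 x).
  { intros Z2 HZ2.
    (* By [NP], the elements that can be settled to [c] form a reservoir. If no large output were
       forced after any of them, this reservoir would continue the fusion. *)
    set (Z3 := fun z => Z2 z /\ len r <= z /\ exists r', ext r' r /\ Settles e r' z c).
    assert (HZ3 : res Z3 Z2).
    { split; [|unfold Z3; tauto]. intros n.
      destruct (HN r c (fun z => Z2 z /\ max n (len r) <= z) Hrq) as [z [r' [[G1 G2] G3]]].
      { eapply res_trans; [apply res_ge, HZ2|]. eapply res_trans; eassumption. }
      exists z. split; [lia|]. split; [exact G1|]. split; [lia|]. exists r'. exact G3. }
    apply NNPP. intros Hno3. apply Hno'. exists Z3.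
    split; [eapply res_trans; eassumption|].
    intros z [G1 [G2 [r' [G3 G4]]]].
    destruct (Legit_add e c q r r' (S0 ++ F) z HG Hrq HL G2 G3 G4) as [s [G5 G6]].
    split; [exists s; split; [|rewrite app_assoc; exact G6]|].
    { apply ext_trans with r'; [apply G5 | eapply ext_trans; eassumption]. }
    split.
    { intros u Hu. apply in_app_or in Hu. destruct Hu as [Hu|[<-|[]]]; [auto|].
      apply HZ, HZ2, G1. }
    intros Z' x HZ' Hx Hforce. apply Hno3. exists z, x, Z'. rewrite app_assoc in Hforce.
    repeat split; auto; [apply HZ' | intros u Hu; apply HZ3, HZ', Hu]. }
  (* The forced output can be made large: if one value [m] recurred in all subreservoirs, a diagonal
     intersection would force [m] on the stem [S0 ++ F] already, whichever element came next. *)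
  assert (Hm : forall m Z2, res Z2 Z -> exists z x Z3, Z2 z /\ len r0 <= x /\ m <= x /\
     res Z3 Z2 /\ Forced c ((S0 ++ F) ++ [z]) Z3 x).
  { induction m as [|m IH].
    - intros Z2 HZ2. destruct (H0 Z2 HZ2) as [z [x [Z3 HH]]]. exists z, x, Z3.
      intuition lia.
    - intros Z2 HZ2. apply NNPP. intros Hno2.
      assert (HIH : forall Z3, res Z3 Z2 -> len r0 <= m /\ exists z Z4, Z3 z /\
         res Z4 Z3 /\ Forced c ((S0 ++ F) ++ [z]) Z4 m).
      { intros Z3 HZ3. destruct (IH Z3) as [z [x [Z4 [G1 [G2 [G3 [G4 G5]]]]]]].
        { eapply res_trans; eassumption. }
        destruct (Nat.eq_dec x m) as [->|Hne]; [split; [exact G2 | eauto]|].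
        exfalso. apply Hno2. exists z, x, Z4. repeat split; auto; try lia.
        - apply HZ3, G1.
        - apply G4.
        - intros u Hu. apply HZ3, G4, Hu. }
      destruct (diagonal Z2 (fun z _ Z => Forced c ((S0 ++ F) ++ [z]) Z m)) with (m0 := 0)
        as [w [v [Hw [_ HwZ]]]].
      + intros z _ Z3 Z4 HF3 HZ4. apply Forced_sub with (3 := HF3);
          [apply extends_refl | apply HZ4].
      + apply HZ2.
      + intros Z3 k HZ3.
        destruct (HIH (fun z => Z3 z /\ k <= z)) as [_ [z [Z4 [[G1 G2] [G3 G4]]]]].
        { eapply res_trans; [apply res_ge, HZ3 | exact HZ3]. }
        exists z, k, Z4. repeat split; auto; [apply G3 | intros u Hu; apply G3, Hu].
      + apply (Hund (fun u => exists j, u = w j) m).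
        * split; [apply inc_range_Inf, Hw|]. intros u [j ->]. apply HZ2, HwZ.
        * apply (HIH Z2), res_refl, HZ2.
        * intros h [Hh1 [Hh2 Hh3]].
          destruct (Hh3 (length (S0 ++ F)) (le_n _)) as [i Hi].
          destruct (HwZ i) as [_ [_ [_ Hf]]]. apply Hf.
          split; [exact Hh1|]. rewrite length_app. simpl. split.
          -- intros j Hj. destruct (le_lt_dec (length (S0 ++ F)) j).
             ++ assert (j = length (S0 ++ F)) as -> by lia.
                rewrite app_nth2, Nat.sub_diag by lia. exact Hi.
             ++ rewrite app_nth1 by assumption. apply Hh2. assumption.
          -- intros j Hj. destruct (Hh3 j) as [k Hk]; [lia|]. exists k. split; [|exact Hk].
             apply (inc_lt_inv w _ _ Hw). rewrite <- Hi, <- Hk. apply inc_lt; [exact Hh1 | lia]. }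
  apply Hno. exists r, (S0 ++ F), Z. split; [exact Hr|]. split; [exact HL|].
  split; [exact HexF|]. split; [exact HZ|].
  intros Z2 m HZ2. destruct (Hm m (fun z => Z2 z /\ m <= z)) as [z [x [Z3 [[G1 G1'] [G2 [G3 [G4 G5]]]]]]].
  { eapply res_trans; [apply res_ge, HZ2 | exact HZ2]. }
  exists z, x, Z3. repeat split; auto; [apply G4 | intros u Hu; apply G4, Hu].
- apply HY0.
- split; [exists r0; rewrite app_nil_r; split; [apply ext_refl | exact HS0]|].
  split; [intros z []|]. intros Z' x HZ' Hx Hf. rewrite app_nil_r in Hf.
  (* A forced output is locked already, hence below [len r0]. *)
  destruct (forced_locked c r0 S0 Z' x); auto; [eapply res_trans; eassumption | lia].
- assert (HwR : res (fun u => exists j, u = w j) Y0).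
  { split; [apply inc_range_Inf, Hw | intros u [j ->]; apply HwY]. }
  apply (HW c r0 S0 (fun u => exists j, u = w j)); auto; [eapply res_trans; eassumption|].
  intros f h A _ [Hh1 [Hh2 Hh3]] HA Ainf _.
  destruct (Ainf (len r0)) as [y [Hy Ay]].
  apply (computed_true h (ec c)) in Ay; [|exact HA].
  apply eval_Hset_use in Ay. destruct Ay as [N HNuse].
  (* The part of [h] consulted by the computation is a stem of the fusion, so this stem would force
     [y]. *)
  destruct (Hfus (fun i => h (length S0 + i))) with (j := N) as [Z [HZ [_ [_ Hund]]]].
  { intros i. rewrite Nat.add_succ_r. apply Hh1. }
  { intros i. apply Hh3. lia. }
  apply (Hund Z y); [apply res_refl, HZ | exact Hy|].
  intros h' [_ [Hh' _]]. apply HNuse. intros i Hi. rewrite Hh'.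
  + destruct (le_lt_dec (length S0) i).
    * rewrite app_nth2 by assumption.
      rewrite nth_indep with (d' := h (length S0 + 0)).
      -- rewrite (map_nth (fun i => h (length S0 + i))), seq_nth by lia. f_equal. lia.
      -- rewrite length_map, length_seq. lia.
    * rewrite app_nth1 by assumption. symmetry. apply Hh2. assumption.
  + rewrite length_app, length_map, length_seq. lia.
Qed.

Definition Tied (z x : nat) : Prop :=
  forall r c, ext r q -> Settles e r z c -> x < len r /\ lock r x = Some (d c).

(** Once [z] is settled, appending it to the stem adds colors only, so the lock required by
    [forced_locked] must be present in [r] itself. *)
Lemma settle_lock c z Z x r : len q <= z -> X z -> res Z X ->
  Forced c (E c ++ [z]) Z x -> ext r q -> Settles e r z c ->
  x < len r /\ lock r x = Some (d c).
Proof.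
intros Hz HXz HZ HF Hr Hs. destruct HB as [HG [_ [_ [HL _]]]].
destruct (Legit_add e c q q r (E c) z HG (ext_refl q) (HL c) Hz Hr Hs) as [s [H1 H2]].
destruct (forced_locked c s (E c ++ [z]) Z x) as [H3 H4]; auto.
- apply ext_trans with r; [apply H1 | exact Hr].
- apply extends_snoc; [apply extends_refl | exact HXz].
- destruct H1 as [H1 [H5 H6]]. destruct (le_lt_dec (len r) x).
  + rewrite H6 in H4 by assumption. discriminate.
  + rewrite <- H5 by assumption. auto.
Qed.

(** The two functionals are played against each other on one element. If their outputs differed,
    both could be locked to the wrong limits and the element could be settled to neither color. The
    same happens if the outputs coincide and [d true = d false]. *)
Lemma tied_exists : Active false (E false) X -> Active true (E true) X ->
  forall Y m, res Y X -> d true <> d false /\ exists z x, Y z /\ m <= z /\ m <= x /\ Tied z x.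
Proof.
intros Ha0 Ha1 Y m HY.
(* Beyond [len q], outputs carry no lock of [q] yet. *)
destruct (diagonal Y (fun z x Z => Forced false (E false ++ [z]) Z x)) with (m0 := max m (len q))
  as [w [v [Hw [Hv Hwv]]]].
- intros z x Z Z' HF HZ. apply Forced_sub with (3 := HF); [apply extends_refl | apply HZ].
- apply HY.
- intros Y' k HY'. apply Ha0. eapply res_trans; eassumption.
- assert (HwR : res (fun u => exists j, u = w j) Y).
  { split; [apply inc_range_Inf, Hw | intros u [j ->]; apply Hwv]. }
  destruct (Ha1 (fun u => exists j, u = w j) (max m (len q)))
    as [z [y [Z [[i ->] [H1 [H2 [H3 H4]]]]]]].
  { eapply res_trans; eassumption. }
  destruct (Hwv i) as [_ [G1 [G2 G3]]].
  set (T := fun u => exists j, i < j /\ u = w j) in G3.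
  assert (HT : res T X).
  { split.
    - intros n. exists (w (S i + n)). split; [pose proof (inc_ge w (S i + n) Hw); lia|].
      exists (S i + n). split; [lia | reflexivity].
    - intros u [j [_ ->]]. apply HY, Hwv. }
  assert (L0 : forall r, ext r q -> Settles e r (w i) false ->
     v i < len r /\ lock r (v i) = Some (d false)).
  { intros r Hr Hs. apply (settle_lock false (w i) T (v i) r); auto; [lia | apply HY, G2]. }
  assert (L1 : forall r, ext r q -> Settles e r (w i) true ->
     y < len r /\ lock r y = Some (d true)).
  { intros r Hr Hs. apply (settle_lock true (w i) Z y r); auto; [lia | apply HY, G2|].
    eapply res_trans; [exact H3|]. eapply res_trans; eassumption. }
  destruct HB as [HG _].
  destruct (lock_to q (v i) (negb (d false))) as [r1 [R1 [R2 [R3 R4]]]]; [lia|].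
  assert (Hvy : v i = y).
  { apply NNPP. intros Hne.
    destruct (lock_to r1 y (negb (d true))) as [r2 [Q1 [Q2 [Q3 Q4]]]].
    { intros _. rewrite R4; [discriminate | congruence | lia]. }
    assert (Hr2 : ext r2 q) by (eapply ext_trans; eassumption).
    destruct (proj2 (HG r2 Hr2) (w i)) as [r3 [c [P1 P2]]].
    assert (Hr3 : ext r3 q) by (eapply ext_trans; eassumption).
    assert (lock r3 y = Some (negb (d true))) by (apply P1; assumption).
    assert (lock r3 (v i) = Some (negb (d false))).
    { apply P1; [destruct Q1; lia|]. apply Q1; assumption. }
    destruct c; [destruct (L1 r3 Hr3 P2) as [_ L] | destruct (L0 r3 Hr3 P2) as [_ L]];
      rewrite L in *; [destruct (d true) | destruct (d false)]; discriminate. }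
  subst y.
  assert (Hd : d true <> d false).
  { intros Hd. destruct (proj2 (HG r1 R1) (w i)) as [r3 [c [P1 P2]]].
    assert (Hr3 : ext r3 q) by (eapply ext_trans; eassumption).
    assert (lock r3 (v i) = Some (negb (d false))) by (apply P1; assumption).
    destruct c; [destruct (L1 r3 Hr3 P2) as [_ L] | destruct (L0 r3 Hr3 P2) as [_ L]];
      rewrite L in *; try rewrite Hd in *; destruct (d false); discriminate. }
  split; [exact Hd|]. exists (w i), (v i). split; [exact G2|].
  split; [lia|]. split; [lia|]. intros r [|]; [apply L1 | apply L0].
Qed.
End Base.

(** * Reservoirs whose elements are tied to single outputs *)

Section TiedReservoir.
Variables (q : cond) (E : bool -> list nat) (w v : nat -> nat).
Let X : nat -> Prop := fun u => exists j, u = w j.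
Hypotheses (HB : Bad q E X) (Hw : inc w) (Hv : inc v)
  (Htied : forall i, Tied q (w i) (v i)) (Hqv : forall i, len q <= v i)
  (Hd : d true <> d false) (Hact : Active false (E false) X).

(** [Good] settles [w i] to some color; [true] would require the lock [d true] on [v i], against
    [d true <> d false]. *)
Lemma tied_settle i r : ext r q -> v i < len r -> lock r (v i) = Some (d false) ->
  forall r1, ext r1 r -> exists r2, ext r2 r1 /\ Settles e r2 (w i) false.
Proof.
intros Hr Hvi Hl r1 Hr1. destruct HB as [HG _].
assert (Hr1q : ext r1 q) by (eapply ext_trans; eassumption).
destruct (proj2 (HG r1 Hr1q) (w i)) as [r2 [c [H1 H2]]]. exists r2. split; [exact H1|].
destruct c; [|exact H2]. exfalso.
assert (Hr2 : ext r2 r) by (eapply ext_trans; eassumption).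
destruct (Htied i r2 true) as [_ H3]; [eapply ext_trans; eassumption | exact H2|].
destruct Hr2 as [_ [_ Hr2]]. destruct (Hr2 _ _ Hvi Hl) as [H4 _]. congruence.
Qed.

(** The forced output is exactly [v i]: any other could be locked wrongly, while a lock [d false] on
    [v i] still lets [w i] be settled to [false], contradicting [forced_locked]. *)
Lemma add_output r S Y : ext r q -> Legit e false r S -> extends (E false) S X -> res Y X ->
  Active false S Y -> exists i r' Z, ext r' r /\ Legit e false r' (S ++ [w i]) /\ Y (w i) /\
    res Z Y /\ Forced false (S ++ [w i]) Z (v i).
Proof.
intros Hr HS Hex HY Ha. destruct HB as [HG _].
(* An element at least [w (len r)] is some [w i] with [len r <= i <= v i], so [v i] is still
   free. *)
destruct (Ha Y (max (len r) (w (len r)))) as [z [x [Z [H1 [H2 [H3 [H4 H5]]]]]]];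
  [apply res_refl, HY|].
destruct (proj2 HY z H1) as [i ->].
assert (Hi : len r <= i).
{ destruct (le_lt_dec (len r) i) as [|Hlt]; [assumption|].
  pose proof (inc_lt w _ _ Hw Hlt). lia. }
assert (Hvi : len r <= v i) by (pose proof (inc_ge v i Hv); lia).
destruct (lock_to r (v i) (d false)) as [r1 [R1 [R2 [R3 R4]]]]; [lia|].
assert (Hr1 : ext r1 q) by (eapply ext_trans; eassumption).
assert (Hx : x = v i).
{ apply NNPP. intros Hne.
  destruct (lock_to r1 x (negb (d false))) as [r2 [Q1 [Q2 [Q3 _]]]].
  { intros _. rewrite R4; [discriminate | exact Hne | lia]. }
  destruct (tied_settle i r1 Hr1 R2 R3 r2 Q1) as [r3 [P1 P2]].
  assert (Hr3 : ext r3 r) by (eapply ext_trans; [|exact R1]; eapply ext_trans; eassumption).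
  destruct (Legit_add e false q r r3 S (w i) HG Hr HS) as [s [L1 L2]]; auto; [lia|].
  destruct (forced_locked q E X HB false s (S ++ [w i]) Z x) as [_ L3]; auto.
  - apply ext_trans with r; [|exact Hr]. apply ext_trans with r3; [apply L1 | exact Hr3].
  - apply extends_snoc; [exact Hex | apply HY, H1].
  - eapply res_trans; eassumption.
  - assert (Hs : ext s r2) by (apply ext_trans with r3; [apply L1 | exact P1]).
    destruct Hs as [_ [_ Hs]]. destruct (Hs _ _ Q2 Q3) as [L4 _].
    rewrite L3 in L4. destruct (d false); discriminate. }
subst x.
destruct (tied_settle i r1 Hr1 R2 R3 r1 (ext_refl r1)) as [r3 [P1 P2]].
assert (Hr3 : ext r3 r) by (eapply ext_trans; eassumption).
destruct (Legit_add e false q r r3 S (w i) HG Hr HS) as [s [L1 L2]]; auto; [lia|].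
exists i, s, Z. split; [apply ext_trans with r3; [apply L1 | exact Hr3]|].
split; [exact L2|]. split; [exact H1|]. split; [exact H4 | exact H5].
Qed.

(* Once [w i] and [S] have the same parity, [w i] and the next element [w k] lie in the same half
   of the p-homogeneous set, so nothing is required of [f'] on that pair.  Hence the lock on [v i]
   may be reversed, the other elements settled, [w k] chosen with [f (v i) x <> d false] for some
   forced output [x], and the lock reversed back. *)
Lemma same_half_absurd r S Y A i B : ext r q -> Legit e false r S -> S = A ++ w i :: B ->
  extends (E false) A X -> (forall z, In z B -> X z) -> res Y X -> Active false S Y ->
  Forced false S Y (v i) -> Nat.even (length A) = Nat.even (length S) -> False.
Proof.
intros Hr HS HSA HexA HBX HY Ha HF Hpar.
destruct HB as [HG [_ [_ [HLq HW]]]].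
assert (HSX : forall z, In z S -> In z (E false) \/ exists j, z = w j).
{ intros z Hz. destruct HexA as [F [-> HFX]]. rewrite HSA in Hz.
  apply in_app_or in Hz. destruct Hz as [Hz|[<-|Hz]]; [|right; eauto | right; apply HBX, Hz].
  apply in_app_or in Hz. destruct Hz as [Hz|Hz]; [left; exact Hz | right; apply HFX, Hz]. }
assert (HEq : forall z, In z (E false) -> Settles e q z false) by apply (HLq false).
destruct HS as [HS1 [HS2 HS3]].
assert (HwiS : In (w i) S) by (rewrite HSA; apply in_or_app; right; left; reflexivity).
assert (Hlock : forall j, In (w j) S -> v j < len r /\ lock r (v j) = Some (d false)).
{ intros j Hj. apply (Htied j r false Hr), HS2, Hj. }
destruct (Hlock i HwiS) as [Hvi1 Hvi2].
(* This condition does not extend [r], but it extends [q] because [v i] is beyond [len q]. *)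
set (rt := setlock r (v i) (negb (d false))).
assert (Hrt : ext rt q).
{ apply setlock_ext; [exact Hr|]. intros b Hb. specialize (Hqv i). lia. }
set (L := filter (fun z => negb (z =? w i)) S).
assert (HLS : forall z, In z L <-> In z S /\ z <> w i).
{ intros z. unfold L. rewrite filter_In, negb_true_iff, Nat.eqb_neq. reflexivity. }
(* The other elements can still be settled: those of [E false] are settled in [q], and each
   remaining [w j] keeps the lock on its own [v j]. *)
destruct (Settles_all e rt false L) as [s [Hs HsL]].
{ intros z Hz p Hp. apply HLS in Hz. destruct Hz as [Hz Hzi].
  destruct (HSX z Hz) as [HzE|[j ->]].
  - exists p. split; [apply ext_refl|]. apply Settles_ext with q; [|auto].
    eapply ext_trans; eassumption.
  - apply (tied_settle j rt); [exact Hrt | apply Hlock, Hz | | exact Hp].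
    simpl. destruct (Nat.eqb_spec (v j) (v i)) as [Hj|_]; [|apply Hlock, Hz].
    exfalso. apply Hzi. f_equal. eapply inc_inj; eassumption. }
assert (Hlrs : len r <= len s) by apply Hs.
assert (Hsq : ext s q) by (eapply ext_trans; eassumption).
destruct (Ha Y (max (len s) (w (len s)))) as [z [x [Z [G1 [G2 [G3 [G4 G5]]]]]]];
  [apply res_refl, HY|].
destruct (proj2 HY z G1) as [k ->].
assert (Hk : len s <= k).
{ destruct (le_lt_dec (len s) k) as [|Hlt]; [assumption|].
  pose proof (inc_lt w _ _ Hw Hlt). lia. }
assert (Hvk : len s <= v k) by (pose proof (inc_ge v k Hv); lia).
(* Only pairs with members of [L] are decided. The length passes [x], so the reversed lock gives the
   pair of [v i] and [x] the wrong color. *)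
destruct (Dec_all e s false (w k) L) with (M := Datatypes.S (max x (max (v k) (w k))))
  as [s1 [T1 [T2 T3]]].
{ eapply Good_ext; eassumption. }
{ intros z Hz. assert (z < len r) by apply HS2, HLS, Hz. split; [lia|].
  intros f Hf. apply (HsL z Hz f (w k) Hf); lia. }
assert (Hs1q : ext s1 q) by (apply ext_trans with s; [apply T1 | exact Hsq]).
assert (Hcol : col s1 (v i) x = negb (d false)).
{ assert (Hls : lock s (v i) = Some (negb (d false))).
  { apply Hs; [exact Hvi1|]. simpl. rewrite Nat.eqb_refl. reflexivity. }
  destruct T1 as [[_ [_ T1]] _]. apply (T1 (v i)); [lia | exact Hls | lia]. }
(* The lock on [v i] is turned back and [v k] is locked too, so that all of [S ++ [w k]] can be
   settled to [false]. *)
set (s2 := setlock (setlock s1 (v i) (d false)) (v k) (d false)).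
assert (Hs2q : ext s2 q).
{ apply setlock_ext; [apply setlock_ext; [exact Hs1q|]|].
  - intros b Hb. specialize (Hqv i). lia.
  - intros b Hb. specialize (Hqv k). lia. }
destruct (Settles_all e s2 false (S ++ [w k])) as [s3 [Hs3 HsS]].
{ assert (Hlast : forall p, ext p s2 -> exists r', ext r' p /\ Settles e r' (w k) false).
  { apply (tied_settle k s2 Hs2q).
    - simpl. lia.
    - simpl. rewrite Nat.eqb_refl. reflexivity. }
  intros z Hz p Hp. apply in_app_or in Hz.
  destruct Hz as [Hz|[<-|[]]]; [|apply Hlast, Hp].
  destruct (HSX z Hz) as [HzE|[j ->]].
  - exists p. split; [apply ext_refl|]. apply Settles_ext with q; [|auto].
    eapply ext_trans; eassumption.
  - destruct (Hlock j Hz) as [Hj1 Hj2].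
    apply (tied_settle j s2 Hs2q); [| |exact Hp].
    + assert (len s <= len s1) by apply T1. simpl. lia.
    + simpl. destruct (v j =? v k); [reflexivity|].
      destruct (Nat.eqb_spec (v j) (v i)) as [_|Hji]; [reflexivity|].
      assert (Hjs : lock s (v j) = Some (d false)).
      { apply Hs; [exact Hj1|]. simpl.
        destruct (Nat.eqb_spec (v j) (v i)); [contradiction | exact Hj2]. }
      apply T1; [lia | exact Hjs]. }
assert (Hs3q : ext s3 q) by (eapply ext_trans; eassumption).
assert (Hls1 : len s <= len s1) by apply T1.
assert (Hls3 : len s1 <= len s3) by apply Hs3.
(* The promise of [r] at [v i] has been broken, but its colors are kept, and decided values depend
   on colors alone. *)
assert (Hag1 : forall f, agree f s3 -> agree f s1).
{ intros f Hf. exact (agree_ext f s3 s2 Hs3 Hf). }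
assert (Hagr : forall f, agree f s3 -> agree f r).
{ intros f Hf. apply (agree_ext f s rt Hs), (agree_ext f s1 s (proj1 T1)), Hag1, Hf. }
apply (HW false s3 (S ++ [w k]) Z Hs3q).
- apply Legit_snoc; auto.
  + intros z Hz. assert (z < len r) by apply HS2, Hz. lia.
  + intros z Hz. split; [|apply HsS, Hz]. apply in_app_or in Hz.
    destruct Hz as [Hz|[<-|[]]]; [|lia]. assert (z < len r) by apply HS2, Hz. lia.
  + intros a b Hab Ho f Hf. apply (HS3 a b Hab Ho), Hagr, Hf.
  + intros a Hal Ho f Hf. apply T3; [|apply Hag1, Hf].
    apply HLS. split; [apply nth_In, Hal|]. intros Heq.
    assert (HlA : length A < length S) by (rewrite HSA, length_app; simpl; lia).
    assert (HnA : nth (length A) S 0 = w i).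
    { rewrite HSA, app_nth2, Nat.sub_diag by lia. reflexivity. }
    destruct (Nat.lt_trichotomy a (length A)) as [Hlt|[->|Hlt]].
    * pose proof (HS1 a (length A) ltac:(lia)). lia.
    (* The position of [w i] has the parity of the new position, so no decision about the pair with
       [w k] is required. *)
    * rewrite <- Nat.negb_even, Nat.even_sub, Hpar, Bool.eqb_reflx in Ho by lia. discriminate.
    * pose proof (HS1 (length A) a ltac:(lia)). lia.
- apply extends_snoc; [|exists k; reflexivity].
  apply extends_trans with (1 := HexA) (Y := X); [|auto].
  exists (w i :: B). split; [exact HSA|]. intros z [<-|Hz]; [exists i; reflexivity | auto].
- eapply res_trans; eassumption.
- intros f h D Hf Hh HD _ Hhom.
  assert (HD1 : D (v i) = true).
  { apply (computed_true h (ec false) D _ HD). apply HF.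
    apply Cyl_extends with (3 := Hh); [|apply G4].
    apply extends_snoc; [apply extends_refl | exact G1]. }
  assert (HD2 : D x = true) by (apply (computed_true h (ec false) D _ HD), G5, Hh).
  assert (Hfx : f (v i) x = d false) by (apply Hhom; auto; lia).
  rewrite (Hag1 f (proj1 Hf)) in Hfx by lia. rewrite Hcol in Hfx.
  destruct (d false); discriminate.
Qed.

(* Of three successive outputs two come from the same half. *)
Lemma tied_absurd : False.
Proof.
assert (HXr : res X X) by (apply res_refl, inc_range_Inf, Hw).
assert (HL : Legit e false q (E false)) by apply HB.
destruct (add_output q (E false) X (ext_refl q) HL (extends_refl _ _) HXr Hact)
  as [i [r1 [Z1 [H1 [H2 [H3 [H4 H5]]]]]]].
assert (Hex1 : extends (E false) (E false ++ [w i]) X)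
  by (apply extends_snoc; [apply extends_refl | exact H3]).
(* Appending [w i] may have destroyed activity, which is restored before the next output is
   sought. *)
destruct (active_exists q E X HB false r1 _ Z1 H1 H2 Hex1 H4)
  as [r2 [S2 [Y2 [K1 [K2 [K3 [K4 K5]]]]]]].
assert (Hr2 : ext r2 q) by (eapply ext_trans; eassumption).
assert (HY2 : res Y2 X) by (eapply res_trans; eassumption).
assert (Hex2 : extends (E false) S2 X)
  by (eapply extends_trans; [exact Hex1 | exact K3 | apply H4]).
assert (HF2 : Forced false S2 Y2 (v i)) by (eapply Forced_sub; [exact K3 | apply K4 | exact H5]).
destruct (add_output r2 S2 Y2 Hr2 K2 Hex2 HY2 K5)
  as [j [r3 [Z3 [L1 [L2 [L3 [L4 L5]]]]]]].
assert (Hr3 : ext r3 q) by (eapply ext_trans; eassumption).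
assert (Hex3 : extends (E false) (S2 ++ [w j]) X)
  by (apply extends_snoc; [exact Hex2 | apply HY2, L3]).
assert (HZ3 : res Z3 X) by (eapply res_trans; eassumption).
destruct (active_exists q E X HB false r3 _ Z3 Hr3 L2 Hex3 HZ3)
  as [r4 [S4 [Y4 [M1 [M2 [M3 [M4 M5]]]]]]].
assert (Hr4 : ext r4 q) by (eapply ext_trans; eassumption).
assert (HY4 : res Y4 X) by (eapply res_trans; eassumption).
assert (HF4 : Forced false S4 Y4 (v j)) by (eapply Forced_sub; [exact M3 | apply M4 | exact L5]).
assert (Hex24 : extends S2 S4 Y2).
{ eapply extends_trans; [|exact M3 | apply L4].
  apply extends_snoc; [apply extends_refl | exact L3]. }
assert (HF4' : Forced false S4 Y4 (v i)).
{ eapply Forced_sub; [exact Hex24 | | exact HF2]. intros u Hu. apply L4, M4, Hu. }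
destruct K3 as [F2 [ES2 HF2X]]. destruct M3 as [F4 [ES4 HF4X]].
destruct Hex24 as [F [ES24 HFX]].
assert (P12 : Nat.even (length (E false)) <> Nat.even (length S2)).
{ intros P. apply (same_half_absurd r2 S2 Y2 (E false) i F2); auto.
  - rewrite ES2, <- app_assoc. reflexivity.
  - apply extends_refl.
  - intros u Hu. apply H4, HF2X, Hu. }
assert (P24 : Nat.even (length S2) <> Nat.even (length S4)).
{ intros P. apply (same_half_absurd r4 S4 Y4 S2 j F4); auto.
  - rewrite ES4, <- app_assoc. reflexivity.
  - intros u Hu. apply HZ3, HF4X, Hu. }
apply (same_half_absurd r4 S4 Y4 (E false) i (F2 ++ F)); auto.
- rewrite ES24, ES2, <- !app_assoc. reflexivity.
- apply extends_refl.
- intros u Hu. apply in_app_or in Hu. destruct Hu as [Hu|Hu];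
    [apply H4, HF2X, Hu | apply HY2, HFX, Hu].
- destruct (Nat.even (length (E false))), (Nat.even (length S2)), (Nat.even (length S4));
    congruence.
Qed.
End TiedReservoir.

(** The two sides are made active one after the other, the reservoir is thinned to tied elements,
    and [tied_absurd] applies. *)
Theorem not_bad q E X : ~ Bad q E X.
Proof.
intros HB.
assert (HL : forall c, Legit e c q (E c)) by apply HB.
assert (HX : res X X) by (apply res_refl, HB).
destruct (active_exists q E X HB false q (E false) X (ext_refl q) (HL false)
  (extends_refl _ _) HX) as [r0 [S0 [Y0 [H1 [H2 [H3 [H4 H5]]]]]]].
destruct (active_exists q E X HB true r0 (E true) Y0 H1 (Legit_ext e true r0 q _ H1 (HL true))
  (extends_refl _ _) H4) as [r1 [S1 [Y1 [K1 [K2 [K3 [K4 K5]]]]]]].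
set (E1 := fun c : bool => if c then S1 else S0).
assert (HB1 : Bad r1 E1 Y1).
{ apply Bad_ext with (1 := HB).
  - eapply ext_trans; eassumption.
  - eapply res_trans; eassumption.
  - intros [|]; [exact K2 | eapply Legit_ext; eassumption].
  - intros [|]; [|exact H3]. eapply extends_trans; [apply extends_refl | exact K3 | apply H4]. }
assert (Ha0 : Active false (E1 false) Y1) by (apply Active_res with Y0; assumption).
assert (HY1 : Inf Y1) by apply HB1.
pose proof (tied_exists r1 E1 Y1 HB1 Ha0 K5) as Htied.
destruct (diagonal Y1 (fun z x _ => Tied r1 z x)) with (m0 := len r1)
  as [w [v [Hw [Hv Hwv]]]]; auto.
{ intros Y m HY. destruct (Htied Y m HY) as [_ [z [x [G1 [G2 [G3 G4]]]]]].
  exists z, x, Y. split; [exact G1|]. split; [exact G2|]. split; [exact G3|].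
  split; [apply res_refl, HY | exact G4]. }
assert (HwR : res (fun u => exists j, u = w j) Y1).
{ split; [apply inc_range_Inf, Hw | intros u [j ->]; apply Hwv]. }
apply (tied_absurd r1 E1 w v); auto.
- apply Bad_ext with (1 := HB1); [apply ext_refl | exact HwR | apply HB1|].
  intros c. apply extends_refl.
- intros i. apply Hwv.
- intros i. apply Hwv.
- apply (Htied Y1 0 (res_refl _ HY1)).
- eapply Active_res; eassumption.
Qed.
End Step.

(** * The generic construction *)

(** The treatment of one functional: not begun, kept from giving a stable coloring, supplied with a
    member of the family, or building two p-homogeneous sets over a common reservoir. *)
Inductive status : Type :=
| Init : status
| Dead : status
| Reservoir : set_nat -> status
| Stems : (bool -> list nat) -> (nat -> Prop) -> status.

Definition dead (e : code) (q : cond) : Prop :=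
  (exists z u, z < u /\ forall f b, obeys f q -> ~ Gam e f z u b) \/
  (exists z, forall r c, ext r q -> ~ Settles e r z c).

Definition valid (e : code) (q : cond) (st : status) : Prop :=
  match st with
  | Init => True
  | Dead => dead e q
  | Reservoir P => infinite P /\
      exists c, forall z r, P z = true -> ext r q -> ~ Settles e r z c
  | Stems E X => Good e q /\ NP e q X /\ Inf X /\ forall c, Legit e c q (E c)
  end.

Definition refines (st' st : status) : Prop :=
  match st, st' with
  | Init, _ => True
  | Dead, Dead => True
  | Reservoir P, Reservoir P' => P' = P
  | Stems E X, Stems E' X' =>
      (forall c, extends (E c) (E' c) X) /\ forall z, X' z -> X z
  | _, _ => False
  end.

Lemma refines_refl st : refines st st.
Proof. destruct st; simpl; auto using extends_refl. Qed.

Lemma refines_trans st1 st2 st3 : refines st1 st2 -> refines st2 st3 -> refines st1 st3.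
Proof.
destruct st3, st2; simpl; try tauto; destruct st1; simpl; try tauto; [congruence|].
intros [H1 H2] [H3 H4]. split; [|auto].
intros c. eapply extends_trans; eauto.
Qed.

Lemma valid_ext e r q st : ext r q -> valid e q st -> valid e r st.
Proof.
intros Hr. destruct st as [| |P|E X]; simpl; auto.
- intros [[z [u [H1 H2]]]|[z H]].
  + left. exists z, u. split; [exact H1|]. intros f b Hf. apply H2.
    eapply obeys_ext; eassumption.
  + right. exists z. intros p c Hp. apply H. eapply ext_trans; eassumption.
- intros [H1 [c H2]]. split; [exact H1|]. exists c. intros z p Hz Hp.
  apply H2; [exact Hz | eapply ext_trans; eassumption].
- intros [H1 [H2 [H3 H4]]]. split; [eapply Good_ext; eassumption|].
  split; [apply NP_ext with q X; auto using res_refl|]. split; [exact H3|].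
  intros c. eapply Legit_ext; eauto.
Qed.

Definition gcond : Type := cond * (code -> status).

Definition gvalid (g : gcond) : Prop := forall e, valid e (fst g) (snd g e).

Definition gext (g' g : gcond) : Prop :=
  ext (fst g') (fst g) /\ forall e, refines (snd g' e) (snd g e).

Lemma gext_refl g : gext g g.
Proof. split; [apply ext_refl | intros; apply refines_refl]. Qed.

Lemma gext_trans g1 g2 g3 : gext g1 g2 -> gext g2 g3 -> gext g1 g3.
Proof.
intros [H1 H2] [H3 H4]. split; [eapply ext_trans; eassumption|].
intros e. eapply refines_trans; eauto.
Qed.

Lemma gvalid_base g r : gvalid g -> ext r (fst g) -> gvalid (r, snd g) /\ gext (r, snd g) g.
Proof.
intros Hg Hr. split; [intros e; apply valid_ext with (fst g); [exact Hr | apply Hg]|].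
split; [exact Hr | intros; apply refines_refl].
Qed.

Lemma gvalid_update g r e st : gvalid g -> ext r (fst g) -> valid e r st ->
  refines st (snd g e) -> exists g', gvalid g' /\ gext g' g /\ fst g' = r /\ snd g' e = st.
Proof.
intros Hg Hr Hst Href.
exists (r, fun e' => if excluded_middle_informative (e' = e) then st else snd g e').
split; [|split; [split; [exact Hr|]|split; [reflexivity|]]]; simpl.
- intros e'. simpl. destruct (excluded_middle_informative (e' = e)) as [->|]; [exact Hst|].
  apply valid_ext with (fst g); [exact Hr | apply Hg].
- intros e'. destruct (excluded_middle_informative (e' = e)) as [->|];
    [exact Href | apply refines_refl].
- destruct (excluded_middle_informative (e = e)); [reflexivity | contradiction].
Qed.

(** * Requirements and their density *)

Inductive req : Type :=
| RLock : nat -> req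
| RDecide : code -> nat -> nat -> bool -> req
| RAvoid : code -> code -> bool -> req
| RWin : code -> code -> bool -> code -> bool -> req
| RLong : code -> bool -> nat -> req.

Definition avoids (q : cond) (P : set_nat) (e : code) (d : bool) : Prop :=
  forall f A, obeys f q ->
    (forall n, eval (ojoin (col_oracle f) (set_oracle P)) e [n] (set_oracle A n)) ->
    infinite A -> ~ (forall x y, A x = true -> A y = true -> x < y -> f x y = d).

Definition pick {T : Type} (t0 t1 : T) (c : bool) : T := if c then t1 else t0.

(** [RDecide] asks whether the value [b] can still occur beyond [N]; this is what turns actual
    limits of [f'] into settled ones. *)
Definition met (R : req) (g : gcond) : Prop :=
  match R with
  | RLock x => x < len (fst g) /\ lock (fst g) x <> None
  | RDecide e z N b =>
      (exists u, N <= u /\ z < u /\ forall f, obeys f (fst g) -> Gam e f z u b) \/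
      (forall f u, obeys f (fst g) -> N <= u -> z < u -> ~ Gam e f z u b)
  | RAvoid e e' d => snd g e <> Init /\
      forall P, snd g e = Reservoir P -> avoids (fst g) P e' d
  | RWin e e0 d0 e1 d1 => snd g e <> Init /\ forall E X, snd g e = Stems E X ->
      exists c, Win (pick e0 e1) (pick d0 d1) c (fst g) (E c) X
  | RLong e c k => snd g e <> Init /\ forall E X, snd g e = Stems E X -> k <= length (E c)
  end.

Lemma req_enum : exists rq : nat -> req, forall R, exists n, rq n = R.
Proof.
destruct code_enum as [en Hen].
set (un := fun n => Cantor.of_nat n). set (od := Nat.odd).
exists (fun n => let (k, n0) := un n in let (a, n1) := un n0 in let (b, n2) := un n1 in
  let (c, n3) := un n2 in let (d, x) := un n3 in
  match k with
  | 0 => RLock x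
  | 1 => RDecide (en a) x c (od d)
  | 2 => RAvoid (en a) (en b) (od d)
  | 3 => RWin (en a) (en b) (od d) (en c) (od x)
  | _ => RLong (en a) (od d) x
  end).
assert (Hod : forall b, od (Nat.b2n b) = b) by (intros [|]; reflexivity).
assert (Htup : forall k a b c d x, exists n, un n =
  (k, Cantor.to_nat (a, Cantor.to_nat (b, Cantor.to_nat (c, Cantor.to_nat (d, x)))))).
{ intros. eexists. apply Cantor.cancel_of_to. }
assert (Hun : forall p, un (Cantor.to_nat p) = p) by apply Cantor.cancel_of_to.
clearbody un od.
intros [x|e z N b|e e' d|e e0 d0 e1 d1|e c k].
- destruct (Htup 0 0 0 0 0 x) as [n Hn]. exists n. rewrite Hn, !Hun. reflexivity.
- destruct (Hen e) as [a <-]. destruct (Htup 1 a 0 N (Nat.b2n b) z) as [n Hn].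
  exists n. rewrite Hn, !Hun, Hod. reflexivity.
- destruct (Hen e) as [a <-]. destruct (Hen e') as [a' <-].
  destruct (Htup 2 a a' 0 (Nat.b2n d) 0) as [n Hn].
  exists n. rewrite Hn, !Hun, Hod. reflexivity.
- destruct (Hen e) as [a <-]. destruct (Hen e0) as [a0 <-]. destruct (Hen e1) as [a1 <-].
  destruct (Htup 3 a a0 a1 (Nat.b2n d0) (Nat.b2n d1)) as [n Hn].
  exists n. rewrite Hn, !Hun, !Hod. reflexivity.
- destruct (Hen e) as [a <-]. destruct (Htup 4 a 0 0 (Nat.b2n c) k) as [n Hn].
  exists n. rewrite Hn, !Hun, Hod. reflexivity.
Qed.

(** If [Good] fails, some extension is dead; if [NP] fails, its counterexample is the reservoir;
    otherwise both stems start empty over the full reservoir. *)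
Lemma activate e g : gvalid g ->
  exists g', gvalid g' /\ gext g' g /\ snd g' e <> Init.
Proof.
intros Hg. destruct (snd g e) as [| |P|E X] eqn:Es;
  [|exists g; rewrite Es; split; [exact Hg | split; [apply gext_refl | discriminate]]..].
assert (Hup : forall r st, ext r (fst g) -> valid e r st -> st <> Init ->
  exists g', gvalid g' /\ gext g' g /\ snd g' e <> Init).
{ intros r st Hr Hst Hne. destruct (gvalid_update g r e st Hg Hr Hst) as [g' [H1 [H2 [_ H3]]]].
  - rewrite Es. exact I.
  - exists g'. rewrite H3. auto. }
destruct (classic (Good e (fst g))) as [HG|HG].
- destruct (classic (NP e (fst g) (fun _ => True))) as [HN|HN].
  + apply (Hup (fst g) (Stems (fun _ => []) (fun _ => True))); [apply ext_refl | | discriminate].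
    simpl. split; [exact HG|]. split; [exact HN|]. split; [intros n; exists n; auto|].
    intros c. split; [simpl; lia|]. split; [intros z []|simpl; lia].
  + apply NNPP. intros Hno. apply HN. intros r c Y Hr HY. apply NNPP. intros Hno'.
    apply Hno.
    set (P := fun z => if excluded_middle_informative (Y z) then true else false).
    assert (HP : forall z, P z = true <-> Y z).
    { intros z. unfold P. destruct (excluded_middle_informative (Y z)); split; auto; discriminate. }
    apply (Hup r (Reservoir P)); [exact Hr | | discriminate]. simpl. split.
    * intros n. destruct (proj1 HY n) as [m [Hm HYm]]. exists m. split; [exact Hm | apply HP, HYm].
    * exists c. intros z r' Hz Hr' Hs. apply Hno'. exists z, r'. split; [apply HP, Hz | auto].
- apply NNPP. intros Hno. apply HG. intros r Hr. split.
  + intros z u Hzu. apply NNPP. intros Hno'. apply Hno.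
    apply (Hup r Dead Hr); [|discriminate]. left. exists z, u. split; [exact Hzu|].
    intros f b Hf Hgam. apply Hno'. exists f, b. auto.
  + intros z. apply NNPP. intros Hno'. apply Hno.
    apply (Hup r Dead Hr); [|discriminate]. right. exists z.
    intros r' c Hr' Hs. apply Hno'. exists r', c. auto.
Qed.

(** Either some output beyond [len q] is possible, and then its use is fixed and it is locked
    against [d]; or all outputs lie below [len q] and the set is finite. *)
Lemma avoid_dense q P e d : exists r, ext r q /\ avoids r P e d.
Proof.
destruct (classic (exists f x, obeys f q /\ len q <= x /\
  eval (ojoin (col_oracle f) (set_oracle P)) e [x] 1)) as [[f [x [Hf [Hx He]]]]|Hno].
- apply eval_use in He. destruct He as [N HN].
  destruct (restrict_ext f q (max (S x) (max N (len q))) Hf) as [H1 [_ H2]]; [lia|].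
  set (r := restrict f q (max (S x) (max N (len q)))) in *.
  destruct (lock_to r x (negb d)) as [r' [R1 [R2 [R3 _]]]].
  { intros _. rewrite H2 by exact Hx. discriminate. }
  exists r'. split; [eapply ext_trans; eassumption|].
  intros g A Hg HA Ainf Hhom.
  assert (Hag : agree g r) by (apply agree_ext with r'; [exact R1 | apply Hg]).
  assert (HAx : eval (ojoin (col_oracle g) (set_oracle P)) e [x] 1).
  { apply HN. intros i Hi. unfold ojoin. destruct (Nat.odd i); [reflexivity|].
    apply col_oracle_agree with N.
    - intros a b Hab Hb. apply Hag; [exact Hab | unfold r, restrict; cbn [len]; lia].
    - pose proof (Nat.div2_decr i i ltac:(lia)). lia. }
  assert (Ax : A x = true).
  { pose proof (eval_det _ _ _ _ _ (HA x) HAx) as E. unfold set_oracle in E.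
    destruct (A x); [reflexivity | discriminate]. }
  destruct (Ainf (len r')) as [y [Hy Ay]].
  pose proof (Hhom x y Ax Ay ltac:(lia)) as E.
  rewrite (proj2 Hg x (negb d) y R2 R3 Hy) in E. destruct d; discriminate.
- exists q. split; [apply ext_refl|]. intros f A Hf HA Ainf _.
  destruct (Ainf (len q)) as [x [Hx Ax]]. apply Hno. exists f, x.
  split; [exact Hf|]. split; [exact Hx|]. specialize (HA x).
  unfold set_oracle at 2 in HA. rewrite Ax in HA. exact HA.
Qed.

(** Contrapositive of [not_bad]: the winning extension changes the stem of one side, keeps the
    other, and thins the common reservoir. *)
Lemma win_dense e ec d g E X : gvalid g -> snd g e = Stems E X ->
  exists g' E' X', gvalid g' /\ gext g' g /\ snd g' e = Stems E' X' /\
    exists c, Win ec d c (fst g') (E' c) X'.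
Proof.
intros Hg Es. pose proof (Hg e) as He. rewrite Es in He.
destruct He as [H1 [H2 [H3 H4]]]. apply NNPP. intros Hno.
apply (not_bad e ec d (fst g) E X). split; [exact H1|]. split; [exact H2|].
split; [exact H3|]. split; [exact H4|]. intros c r S Y Hr HS Hex HY HW. apply Hno.
set (E' := fun c' => if eqb c' c then S else E c').
assert (HE' : E' c = S) by (unfold E'; rewrite eqb_reflx; reflexivity).
destruct (gvalid_update g r e (Stems E' Y) Hg Hr) as [g' [G1 [G2 [G3 G4]]]].
- simpl. split; [eapply Good_ext; eassumption|]. split; [eapply NP_ext; eassumption|].
  split; [apply HY|]. intros c'. unfold E'.
  destruct (eqb_spec c' c) as [->|]; [exact HS | eapply Legit_ext; eauto].
- rewrite Es. simpl. split; [|apply HY]. intros c'. unfold E'.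
  destruct (eqb_spec c' c) as [->|]; [exact Hex | apply extends_refl].
- exists g', E', Y. split; [exact G1|]. split; [exact G2|]. split; [exact G4|].
  exists c. rewrite G3, HE'. exact HW.
Qed.

Lemma long_dense e c k g E X : gvalid g -> snd g e = Stems E X ->
  exists g' E' X', gvalid g' /\ gext g' g /\ snd g' e = Stems E' X' /\ k <= length (E' c).
Proof.
intros Hg Es. induction k as [|k [g1 [E1 [X1 [G1 [G2 [G3 G4]]]]]]].
- exists g, E, X. split; [exact Hg|]. split; [apply gext_refl|]. split; [exact Es | lia].
- pose proof (G1 e) as He. rewrite G3 in He. destruct He as [H1 [H2 [H3 H4]]].
  destruct (H2 (fst g1) c (fun z => X1 z /\ len (fst g1) <= z) (ext_refl _))
    as [z [r [[K1 K2] [K3 K4]]]]; [apply res_ge, H3|].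
  destruct (Legit_add e c _ _ r (E1 c) z H1 (ext_refl _) (H4 c) K2 K3 K4) as [s [K5 K6]].
  assert (Hs : ext s (fst g1)) by (apply ext_trans with r; [apply K5 | exact K3]).
  set (E' := fun c' => if eqb c' c then E1 c ++ [z] else E1 c').
  destruct (gvalid_update g1 s e (Stems E' X1) G1 Hs) as [g' [L1 [L2 [L3 L4]]]].
  + simpl. split; [eapply Good_ext; eassumption|].
    split; [apply NP_ext with (fst g1) X1; auto using res_refl|].
    split; [exact H3|]. intros c'. unfold E'.
    destruct (eqb_spec c' c) as [->|]; [exact K6 | eapply Legit_ext; eauto].
  + rewrite G3. simpl. split; [|auto]. intros c'. unfold E'.
    destruct (eqb_spec c' c) as [->|]; [|apply extends_refl].
    apply extends_snoc; [apply extends_refl | exact K1].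
  + exists g', E', X1. split; [exact L1|]. split; [eapply gext_trans; eassumption|].
    split; [exact L4|]. unfold E'. rewrite eqb_reflx, length_app. simpl. lia.
Qed.

Lemma met_dense R g : gvalid g -> exists g', gvalid g' /\ gext g' g /\ met R g'.
Proof.
assert (Hact : forall e, gvalid g -> (forall g1, gvalid g1 -> snd g1 e <> Init ->
  exists g', gvalid g' /\ gext g' g1 /\ met R g') -> exists g', gvalid g' /\ gext g' g /\ met R g').
{ intros e Hg H. destruct (activate e g Hg) as [g1 [H1 [H2 H3]]].
  destruct (H g1 H1 H3) as [g' [H4 [H5 H6]]]. exists g'.
  split; [exact H4|]. split; [eapply gext_trans; eassumption | exact H6]. }
intros Hg. destruct R as [x|e z N b|e e' d|e e0 d0 e1 d1|e c k].
- assert (Hr : exists r, ext r (fst g) /\ x < len r /\ lock r x <> None).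
  { destruct (lock (fst g) x) as [b|] eqn:El; [destruct (le_lt_dec (len (fst g)) x)|].
    - destruct (lock_to (fst g) x b) as [r [H1 [H2 [H3 _]]]]; [lia|].
      exists r. split; [exact H1|]. split; [exact H2 | congruence].
    - exists (fst g). split; [apply ext_refl|]. split; [assumption | congruence].
    - destruct (lock_to (fst g) x true) as [r [H1 [H2 [H3 _]]]]; [congruence|].
      exists r. split; [exact H1|]. split; [exact H2 | congruence]. }
  destruct Hr as [r [Hr Hm]]. exists (r, snd g).
  split; [apply gvalid_base; auto|]. split; [apply gvalid_base; auto | exact Hm].
- destruct (classic (exists f u, obeys f (fst g) /\ N <= u /\ z < u /\ Gam e f z u b))
    as [[f [u [Hf [Hu [Hzu HG]]]]]|Hno].
  + destruct (Dec_intro e f (fst g) z u b 0 Hf HG) as [r [[Hr _] [_ [_ HD]]]].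
    exists (r, snd g). split; [apply gvalid_base; auto|]. split; [apply gvalid_base; auto|].
    left. exists u. split; [exact Hu|]. split; [exact Hzu|]. intros f' Hf'. apply HD, Hf'.
  + exists g. split; [exact Hg|]. split; [apply gext_refl|]. right.
    intros f u Hf Hu Hzu HG. apply Hno. eauto 6.
- apply (Hact e Hg). clear g Hact Hg. intros g Hg Hne. destruct (snd g e) as [| |P|E X] eqn:Es;
    [contradiction | exists g | |exists g];
    try (split; [exact Hg|]; split; [apply gext_refl|]; simpl; rewrite Es;
         split; [discriminate | intros; discriminate]).
  destruct (avoid_dense (fst g) P e' d) as [r [Hr Ha]]. exists (r, snd g).
  split; [apply gvalid_base; auto|]. split; [apply gvalid_base; auto|].
  simpl. rewrite Es. split; [discriminate|]. intros P' HP'. injection HP' as <-. exact Ha.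
- apply (Hact e Hg). clear g Hact Hg. intros g Hg Hne. destruct (snd g e) as [| |P|E X] eqn:Es;
    [contradiction | exists g | exists g |];
    try (split; [exact Hg|]; split; [apply gext_refl|]; simpl; rewrite Es;
         split; [discriminate | intros; discriminate]).
  destruct (win_dense e (pick e0 e1) (pick d0 d1) g E X Hg Es)
    as [g' [E' [X' [H1 [H2 [H3 H4]]]]]].
  exists g'. split; [exact H1|]. split; [exact H2|]. simpl. rewrite H3.
  split; [discriminate|]. intros E'' X'' HE. injection HE as <- <-. exact H4.
- apply (Hact e Hg). clear g Hact Hg. intros g Hg Hne. destruct (snd g e) as [| |P|E X] eqn:Es;
    [contradiction | exists g | exists g |];
    try (split; [exact Hg|]; split; [apply gext_refl|]; simpl; rewrite Es;
         split; [discriminate | intros; discriminate]).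
  destruct (long_dense e c k g E X Hg Es) as [g' [E' [X' [H1 [H2 [H3 H4]]]]]].
  exists g'. split; [exact H1|]. split; [exact H2|]. simpl. rewrite H3.
  split; [discriminate|]. intros E'' X'' HE. injection HE as <- <-. exact H4.
Qed.

Lemma generic_sequence : exists s : nat -> gcond,
  (forall n, gvalid (s n)) /\ (forall n m, n <= m -> gext (s m) (s n)) /\
  (forall R, exists n, met R (s n)).
Proof.
destruct req_enum as [rq Hrq].
destruct (dependent_choice gvalid (fun n g g' => gext g' g /\ met (rq n) g')
  (Cond 0 (fun _ _ => false) (fun _ => None), fun _ => Init)) as [s [_ Hs]].
- intros e. exact I.
- intros n g Hg. apply met_dense, Hg.
- exists s. split; [intros n; apply Hs|]. split.
  + intros n m Hnm. induction Hnm as [|m Hnm IH]; [apply gext_refl|].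
    eapply gext_trans; [apply Hs | exact IH].
  + intros R. destruct (Hrq R) as [n <-]. exists (S n). apply Hs.
Qed.

(** * Objects read off from a generic sequence *)

Lemma side_iff h b x : inc h -> (side h b x = true <-> exists i, h i = x /\ Nat.even i = b).
Proof.
intros Hh. unfold side. rewrite existsb_exists. split.
- intros [i [_ H]]. apply andb_prop in H. destruct H as [H1 H2].
  apply Nat.eqb_eq in H1. apply eqb_prop in H2. eauto.
- intros [i [<- <-]]. exists i. split.
  + apply in_seq. pose proof (inc_ge h i Hh). lia.
  + rewrite Nat.eqb_refl, eqb_reflx. reflexivity.
Qed.

Lemma side_infinite h b : inc h -> infinite (side h b).
Proof.
intros Hh n. destruct b.
- exists (h (2 * n)). split; [pose proof (inc_ge h (2 * n) Hh); lia|].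
  apply side_iff; [exact Hh|]. eexists. split; [reflexivity|]. apply Nat.even_even.
- exists (h (2 * n + 1)). split; [pose proof (inc_ge h (2 * n + 1) Hh); lia|].
  apply side_iff; [exact Hh|]. eexists. split; [reflexivity|]. apply Nat.even_odd.
Qed.

Section Generic.
Variable s : nat -> gcond.
Hypotheses (Hval : forall n, gvalid (s n)) (Hext : forall n m, n <= m -> gext (s m) (s n))
  (Hmet : forall R, exists n, met R (s n)).

(** The union of the finite colorings: column [y] is read at a stage longer than [y], where all
    earlier locks have been respected. *)
Lemma generic_coloring : exists f, forall n, obeys f (fst (s n)).
Proof.
assert (Hlen : forall y, exists n, y < len (fst (s n))).
{ intros y. destruct (Hmet (RLock y)) as [n [Hn _]]. eauto. }
set (k := fun y => proj1_sig (constructive_indefinite_description _ (Hlen y))).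
assert (Hk : forall y, y < len (fst (s (k y)))).
{ intros y. exact (proj2_sig (constructive_indefinite_description _ (Hlen y))). }
exists (fun x y => col (fst (s (k y))) x y). intros n. split.
- intros x y Hxy Hy. destruct (Nat.le_ge_cases n (k y)) as [H|H]; apply Hext in H;
    destruct H as [[_ [H _]] _]; [|symmetry]; apply H; auto.
- intros x b y Hx Hb Hy. destruct (Nat.le_ge_cases n (k y)) as [H|H]; apply Hext in H.
  + destruct H as [[_ [_ H]] _]. apply (H x b Hx Hb). auto.
  + destruct H as [[H _] _]. specialize (Hk y). lia.
Qed.

Lemma status_cmp e n m : snd (s n) e <> Init -> snd (s m) e <> Init ->
  match snd (s n) e, snd (s m) e with
  | Dead, Dead => True
  | Reservoir P, Reservoir P' => P = P'
  | Stems E X, Stems E' X' => (forall c, extends (E c) (E' c) X) \/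
                              (forall c, extends (E' c) (E c) X')
  | _, _ => False
  end.
Proof.
intros Hn Hm.
destruct (Nat.le_ge_cases n m) as [H|H]; apply Hext in H; destruct H as [_ H]; specialize (H e);
  destruct (snd (s n) e), (snd (s m) e); simpl in H; try contradiction; auto;
  destruct H; auto.
Qed.

Variable f : coloring.
Hypothesis Hf : forall n, obeys f (fst (s n)).

Lemma generic_stable : stable f.
Proof.
intros x. destruct (Hmet (RLock x)) as [n [Hx Hl]].
destruct (lock (fst (s n)) x) as [b|] eqn:El; [|contradiction].
exists b, (len (fst (s n))). intros u Hu _. apply (proj2 (Hf n) x b u Hx El Hu).
Qed.

Lemma generic_avoids e n P X : snd (s n) e = Reservoir P ->
  computable_in X (ojoin (col_oracle f) (set_oracle P)) -> ~ homogeneous f X.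
Proof.
intros Hn [e' He'] [Xinf [d Hd]].
destruct (Hmet (RAvoid e e' d)) as [m [Hm1 Hm2]].
pose proof (status_cmp e n m) as Hc. rewrite Hn in Hc.
specialize (Hc ltac:(discriminate) Hm1).
destruct (snd (s m) e) as [| |P'|E' X'] eqn:Em; try contradiction. subst P'.
apply (Hm2 P eq_refl f X); auto.
Qed.

Variables (f' : coloring) (e : code).
Hypotheses (Hstab : stable f')
  (He : forall n, eval (col_oracle f) e [n] (col_oracle f' n)).

Lemma generic_Gam z u b : z < u -> (Gam e f z u b <-> f' z u = b).
Proof.
intros Hzu.
assert (HG : Gam e f z u (f' z u)).
{ unfold Gam. rewrite <- col_oracle_pair by exact Hzu. apply He. }
split; [intros H; eapply Gam_det; eassumption | intros <-; exact HG].
Qed.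

(** [RDecide] for the wrong color cannot be met by a wrong value beyond [N]; so some stage excludes
    such values, and lengthening past [N] settles [z]. *)
Lemma generic_settles z c n : (exists N, forall u, N <= u -> z < u -> f' z u = c) ->
  exists r, ext r (fst (s n)) /\ Settles e r z c.
Proof.
intros [N HN]. destruct (Hmet (RDecide e z N (negb c))) as [m [[u [Hu [Hzu H]]]|H]].
- specialize (H f (Hf m)). apply generic_Gam in H; [|exact Hzu].
  rewrite HN in H by assumption. destruct c; discriminate.
- destruct (ext_nolock_len (fst (s (max n m))) N) as [r [[Hr _] Hl]].
  exists r. split; [eapply ext_trans; [exact Hr | apply Hext; lia]|].
  intros g u Hg Hu Hzu. apply H; [|lia | exact Hzu].
  apply obeys_ext with (2 := Hg). eapply ext_trans; [exact Hr | apply Hext; lia].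
Qed.

Lemma generic_not_dead n : snd (s n) e <> Dead.
Proof.
intros En. pose proof (Hval n e) as H. rewrite En in H.
destruct H as [[z [u [Hzu H]]]|[z H]].
- apply (H f (f' z u) (Hf n)), generic_Gam; auto.
- destruct (Hstab z) as [c Hc].
  destruct (generic_settles z c n Hc) as [r [H1 H2]]. exact (H r c H1 H2).
Qed.

(** A limit [c] at a point of [P] would be settled by an extension, which validity forbids; so all
    limits are [negb c] and the greedy construction applies. *)
Lemma generic_reservoir n P : snd (s n) e = Reservoir P ->
  exists H, p_homogeneous f' H /\ computable_in H (ojoin (col_oracle f) (set_oracle P)).
Proof.
intros En. pose proof (Hval n e) as H. rewrite En in H. destruct H as [Pinf [c Hc]].
apply computable_p_homogeneous with (negb c); [exists e; exact He | exact Pinf|].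
intros z Hz. destruct (Hstab z) as [b Hb].
destruct (generic_settles z b n Hb) as [r [H1 H2]].
destruct Hb as [N HN]. exists N. intros u Hu Hzu. rewrite HN by assumption.
destruct b, c; try reflexivity; exfalso; exact (Hc z r Hz H1 H2).
Qed.

(** The stems of side [c] are nested and grow without bound, so they define one enumeration [h]
    lying in every cylinder; the values between its halves were decided by legitimacy. *)
Lemma generic_stems n0 E0 X0 c : snd (s n0) e = Stems E0 X0 ->
  exists h, p_homogeneous f' (Hset h) /\
    forall n E X, snd (s n) e = Stems E X -> Cyl (E c) X h.
Proof.
intros En0.
assert (Hlong : forall i, exists L, i < length L /\
  exists n E X, snd (s n) e = Stems E X /\ L = E c).
{ intros i. destruct (Hmet (RLong e c (S i))) as [n [H1 H2]].
  pose proof (status_cmp e n0 n) as Hc. rewrite En0 in Hc. specialize (Hc ltac:(discriminate) H1).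
  destruct (snd (s n) e) as [| |P|E X] eqn:En; try contradiction.
  exists (E c). split; [exact (H2 E X eq_refl) | eauto]. }
set (h := fun i => nth i (proj1_sig (constructive_indefinite_description _ (Hlong i))) 0).
assert (Hh : forall i, exists n E X, snd (s n) e = Stems E X /\ i < length (E c) /\
  h i = nth i (E c) 0).
{ intros i. unfold h. destruct (constructive_indefinite_description _ (Hlong i))
    as [L [H1 [n [E [X [H2 ->]]]]]]. simpl. eauto 7. }
clearbody h.
assert (Hstem : forall n E X, snd (s n) e = Stems E X ->
  (forall i, i < length (E c) -> h i = nth i (E c) 0) /\
  (forall i, length (E c) <= i -> X (h i))).
{ intros n E X En.
  assert (Hcmp : forall i, exists E' X', i < length (E' c) /\ h i = nth i (E' c) 0 /\
    (extends (E c) (E' c) X \/ extends (E' c) (E c) X')).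
  { intros i. destruct (Hh i) as [m [E' [X' [H1 [H2 H3]]]]]. exists E', X'.
    split; [exact H2|]. split; [exact H3|].
    pose proof (status_cmp e n m) as Hc. rewrite En, H1 in Hc.
    destruct (Hc ltac:(discriminate) ltac:(discriminate)); auto. }
  split; intros i Hi; destruct (Hcmp i) as [E' [X' [H2 [-> [[F [HF HFX]]|[F [HF HFX]]]]]]];
    rewrite HF in *; rewrite ?length_app in *.
  - apply app_nth1, Hi.
  - symmetry. apply app_nth1, H2.
  - rewrite app_nth2 by exact Hi. apply HFX, nth_In. lia.
  - lia. }
assert (Hpair : forall i j, exists n E X, snd (s n) e = Stems E X /\
  i < length (E c) /\ j < length (E c)).
{ intros i j. destruct (Hlong (max i j)) as [L [H1 [n [E [X [H2 ->]]]]]].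
  exists n, E, X. split; [exact H2 | lia]. }
assert (Hlegit : forall n E X, snd (s n) e = Stems E X -> Legit e c (fst (s n)) (E c)).
{ intros n E X En. pose proof (Hval n e) as H. rewrite En in H. apply H. }
assert (Hinc : inc h).
{ intros i. destruct (Hpair i (S i)) as [n [E [X [En [H1 H2]]]]].
  destruct (Hstem n E X En) as [H3 _]. rewrite !H3 by assumption.
  apply (Hlegit n E X En). lia. }
assert (Hcol : forall i j, i < j -> Nat.even i <> Nat.even j -> f' (h i) (h j) = c).
{ intros i j Hij Hpar. apply generic_Gam; [apply inc_lt; assumption|].
  destruct (Hpair i j) as [n [E [X [En [H1 H2]]]]].
  destruct (Hstem n E X En) as [H3 _]. rewrite !H3 by assumption.
  apply (Hlegit n E X En); [lia| |apply Hf].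
  rewrite <- Nat.negb_even, Nat.even_sub by lia.
  destruct (Nat.even i), (Nat.even j); simpl; congruence. }
exists h. split.
- exists (side h true), (side h false). split; [|reflexivity].
  split; [apply side_infinite, Hinc|]. split; [apply side_infinite, Hinc|].
  exists c. intros x y Hx Hy Hxy.
  apply side_iff in Hx, Hy; try exact Hinc.
  destruct Hx as [i [<- Hi]], Hy as [j [<- Hj]]. unfold colsym.
  destruct (Nat.ltb_spec (h i) (h j)) as [Hlt|Hge].
  + apply Hcol; [apply (inc_lt_inv h); assumption | congruence].
  + apply Hcol; [apply (inc_lt_inv h); [exact Hinc | lia] | congruence].
- intros n E X En. destruct (Hstem n E X En). split; auto.
Qed.
End Generic.

Theorem theorem3p1 :
  exists (f : coloring) (Y : set_nat -> Prop),
    stable f /\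
    (forall P, Y P -> infinite P) /\
    (* (i) *)
    (forall P, Y P ->
       forall X, computable_in X (ojoin (col_oracle f) (set_oracle P)) ->
         ~ homogeneous f X) /\
    (* (ii) *)
    (forall f' : coloring,
       stable f' ->
       Tred (col_oracle f') (col_oracle f) ->
       (exists P H, Y P /\ p_homogeneous f' H /\
          computable_in H (ojoin (col_oracle f) (set_oracle P)))
       \/
       (exists H, p_homogeneous f' H /\
          forall X, computable_in X (set_oracle H) -> ~ homogeneous f X)).
Proof.
destruct generic_sequence as [s [Hval [Hext Hmet]]].
destruct (generic_coloring s Hext Hmet) as [f Hf].
exists f, (fun P => exists e n, snd (s n) e = Reservoir P).
split; [apply (generic_stable s Hmet f Hf)|]. split.
{ intros P [e [n En]]. pose proof (Hval n e) as H. rewrite En in H. apply H. }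
split.
{ intros P [e [n En]] X. apply (generic_avoids s Hext Hmet f Hf e n P X En). }
intros f' Hstab [e He].
(* This requirement serves to reach a stage where [e] has left [Init]. *)
destruct (Hmet (RAvoid e e true)) as [n [Hn _]].
destruct (snd (s n) e) as [| |P|E X] eqn:En; [contradiction| | |].
- exfalso. exact (generic_not_dead s Hval Hext Hmet f Hf f' e Hstab He n En).
- left. destruct (generic_reservoir s Hval Hext Hmet f Hf f' e Hstab He n P En) as [H [H1 H2]].
  exists P, H. eauto.
(* If both p-homogeneous sets computed homogeneous sets, the two functionals and colors would form
   an instance of [RWin], which defeats one of them. *)
- right. apply NNPP. intros Hno.
  assert (Hc : forall c, exists h,
    (forall n E X, snd (s n) e = Stems E X -> Cyl (E c) X h) /\
    exists A e' d, (forall n, eval (set_oracle (Hset h)) e' [n] (set_oracle A n)) /\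
      infinite A /\ forall x y, A x = true -> A y = true -> x < y -> f x y = d).
  { intros c. destruct (generic_stems s Hval Hext Hmet f Hf f' e He n E X c En) as [h [H1 H2]].
    exists h. split; [exact H2|]. apply NNPP. intros Hno'. apply Hno.
    exists (Hset h). split; [exact H1|]. intros A [e' He'] [Ainf [d Hd]].
    apply Hno'. exists A, e', d. auto. }
  destruct (Hc false) as [h0 [Hh0 [A0 [e0 [d0 [He0 [Hi0 Hd0]]]]]]].
  destruct (Hc true) as [h1 [Hh1 [A1 [e1 [d1 [He1 [Hi1 Hd1]]]]]]].
  destruct (Hmet (RWin e e0 d0 e1 d1)) as [m [Hm1 Hm2]].
  pose proof (status_cmp s Hext e n m) as Hcmp. rewrite En in Hcmp.
  specialize (Hcmp ltac:(discriminate) Hm1).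
  destruct (snd (s m) e) as [| |P|E' X'] eqn:Em; try contradiction.
  destruct (Hm2 E' X' eq_refl) as [[|] HW].
  + exact (HW f h1 A1 (Hf m) (Hh1 m E' X' Em) He1 Hi1 Hd1).
  + exact (HW f h0 A0 (Hf m) (Hh0 m E' X' Em) He0 Hi0 Hd0).
Qed.
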